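(* Let $i_0,k_0>0$ be integers, $R>0$, $\overline B_R:=\{z\in\mathbb{C}^{i_0}:|z|_{\mathbb{C}^{i_0}}\le R\}$, let $U\subset\mathbb{C}=\mathbb{R}^2$ be a nonempty open set, and let $\rho:U\to\mathbb{C}$ be a function such that (i) $\rho$ is locally bounded and continuous almost everywhere in $U$ (with respect to the two-dimensional Lebesgue measure), and (ii) $\Delta^m\rho$ does not vanish identically in $U$ for any $m=0,1,2,\dots$, where $\Delta=\partial^2/\partial x^2+\partial^2/\partial y^2$, $z=x+iy$, is the Laplace operator defined in the sense of distributions. If $f:\overline B_R\to\mathbb{C}^{k_0}$ is continuous and $\epsilon>0$, then there exist an integer $j_0>0$ and parameters $a_j\in\mathbb{C}^{i_0}$, $j=1,2,\dots,j_0$, $b=(b_1,\dots,b_{j_0})\in\mathbb{C}^{j_0}$, and $(c_{kj})\in\mathbb{C}^{k_0\times j_0}$ such that $$a_j\cdot z+b_j\in U\quad\text{for every } z\in\overline B_R\text{ and } j=1,2,\dots,j_0,$$ and such that the function $\mathcal N=(\mathcal N_1,\dots,\mathcal N_{k_0}):\overline B_R\to\mathbb{C}^{k_0}$ defined componentwise by $$\mathcal N_k(z):=\sum_{j=1}^{j_0}c_{kj}\,\rho(a_j\cdot z+b_j)$$ satisfies $$\sup_{z\in\overline B_R}\big|\mathcal N(z)-f(z)\big|_{\mathbb{C}^{k_0}}\le\epsilon.$$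
   Context: For $a=(a_1,\dots,a_{i_0})\in\mathbb{C}^{i_0}$ and $z\in\mathbb{C}^{i_0}$, $a\cdot z:=\sum_{i=1}^{i_0}a_iz_i$ (no complex conjugation). $|\cdot|_{\mathbb{C}^d}$ is the Euclidean norm on $\mathbb{C}^d$. *)

(* Defs.v *)
From HB Require Import structures.
From mathcomp Require Import all_boot all_order all_algebra.
From mathcomp Require Import complex.
From mathcomp Require Import all_classical all_reals all_analysis.

Set Implicit Arguments.
Unset Strict Implicit.
Unset Printing Implicit Defensive.

Import Order.TTheory GRing.Theory Num.Theory.
Import numFieldNormedType.Exports.
Import ComplexField.Normc.

Local Open Scope classical_set_scope.
Local Open Scope ring_scope.
Local Open Scope complex_scope.

(* The complex numbers are R[i].  The library's modulus topology on a
   numFieldType K is inferred on K^o and on abstract K, but not on the concrete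
   carrier R[i]; these instances transport it, so that R[i] and, through the
   product topology on matrices, 'rV[R[i]]_n carry their usual topologies. *)
HB.instance Definition _ (R : realType) := GRing.ComAlgebra.copy R[i] R[i]^o.
HB.instance Definition _ (R : realType) := Vector.copy R[i] R[i]^o.
HB.instance Definition _ (R : realType) := NormedModule.copy R[i] R[i]^o.

(* The library norm on matrices is the sup norm, hence this one. *)
Definition enorm (R : realType) (n : nat) (z : 'rV[R[i]]_n) : R :=
  Num.sqrt (\sum_(i < n) normc (z 0 i) ^+ 2).

Definition ecball (R : realType) (n : nat) (r : R) : set 'rV[R[i]]_n :=
  [set z | enorm z <= r].

Definition cdot (R : realType) (n : nat) (a z : 'rV[R[i]]_n) : R[i] :=
  \sum_(i < n) a 0 i * z 0 i.

Definition toC (R : realType) (p : R * R) : R[i] := p.1 +i* p.2.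

Notation lebesgue2 R := ((@lebesgue_measure R \x @lebesgue_measure R)%E).

Definition ae_continuous (R : realType) (U : set R[i]) (rho : R[i] -> R[i]) :=
  {ae lebesgue2 R, forall p, U (toC p) -> {for toC p, continuous rho}}.

Definition dirx (R : realType) : R * R := (1, 0).
Definition diry (R : realType) : R * R := (0, 1).

Fixpoint Ck (R : realType) (k : nat) (g : R * R -> R) : Prop :=
  if k is k'.+1 then
    [/\ continuous g,
        forall p, derivable g p (dirx R) /\ derivable g p (diry R),
        Ck k' ('D_(dirx R) g) & Ck k' ('D_(diry R) g)]
  else continuous g.

Definition csmooth (R : realType) (phi : R * R -> R[i]) : Prop :=
  forall k, Ck k (fun p => complex.Re (phi p)) /\
            Ck k (fun p => complex.Im (phi p)).

(* Derivative along a real direction, taken on real and imaginary parts: this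
   is not the complex derivative. *)
Definition cpartial (R : realType) (v : R * R) (phi : R * R -> R[i]) :
    R * R -> R[i] :=
  fun p => 'D_v (fun q => complex.Re (phi q)) p +i*
           'D_v (fun q => complex.Im (phi q)) p.

Definition test_function (R : realType) (U : set R[i])
    (phi : R * R -> R[i]) : Prop :=
  let supp := closure [set p | phi p != 0] in
  [/\ csmooth phi, compact supp & supp `<=` @toC R @^-1` U].

(* A distribution is represented by its values on test functions (those on
   other functions are irrelevant). *)
Definition cdistribution (R : realType) : Type := (R * R -> R[i]) -> R[i].

(* The library integral of a nonnegative function is the supremum over simple
   measurable functions below it, so it is correct also for functions that are
   measurable only with respect to the completed sigma-algebra, such as an
   almost everywhere continuous rho. *)
Definition dist_of (R : realType) (U : set R[i]) (rho : R[i] -> R[i]) :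
    cdistribution R :=
  fun phi =>
    (\int[lebesgue2 R]_(p in @toC R @^-1` U)
        complex.Re (rho (toC p) * phi p)) +i*
    (\int[lebesgue2 R]_(p in @toC R @^-1` U)
        complex.Im (rho (toC p) * phi p)).

Definition dist_partial (R : realType) (v : R * R) (T : cdistribution R) :
    cdistribution R :=
  fun phi => - T (cpartial v phi).

Definition dist_laplacian (R : realType) (T : cdistribution R) :
    cdistribution R :=
  fun phi => dist_partial (dirx R) (dist_partial (dirx R) T) phi
           + dist_partial (diry R) (dist_partial (diry R) T) phi.

Definition dist_vanishes (R : realType) (U : set R[i]) (T : cdistribution R) :
    Prop :=
  forall phi, test_function U phi -> T phi = 0.

(* Main.v *)
Require Import Defs.
From mathcomp Require Import all_boot all_order all_algebra.
From mathcomp Require Import complex.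
From mathcomp Require Import all_classical all_reals all_analysis.
From mathcomp Require Import measurable_realfun.
From mathcomp Require Import ring lra.

Set Implicit Arguments.
Unset Strict Implicit.
Unset Printing Implicit Defensive.

Import Order.TTheory GRing.Theory Num.Theory.
Import numFieldNormedType.Exports.

Local Open Scope classical_set_scope.
Local Open Scope ring_scope.

Import ComplexField.Normc.

(** The functions z |-> rho (a . z + b) span a subspace whose uniform closure on
    the ball is shown to contain every monomial in the coordinates z_i and
    their conjugates; the Stone-Weierstrass theorem then gives everything.

    Let phi be smooth with compact support in U.  For small a, the average
    z |-> \int rho(t) phi(t - a . z) dt is in the closure, being a limit of the
    Riemann sums \sum_j h^2 phi(t_j) rho(t_j + a . z).  The convergence has to be
    uniform in the translation w = a . z ([uniform_riemann_sums]).  It is, because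
    the grid is translated together with phi: the error at t is then governed by
    the oscillation of rho around t at scale h, whatever w is, and the points
    with a large oscillation at scale h form an open set whose measure tends to
    0 with h, as rho is continuous almost everywhere ([small_oscillation]).

    These averages are smooth in a, all derivatives falling on phi.  Their
    difference quotients in the real directions e_i and i e_i of a converge
    uniformly and remain in the closure; combining the two directions multiplies
    the function by z_i, or by its conjugate, while phi is replaced by one of its
    Wirtinger derivatives ([weighted_step]).  Starting from the constant 1,
    iterating, and setting a = 0 at the end, one finds in the closure the
    monomial z^alpha conj(z)^beta times the number \int rho D phi, where D is a
    product of |alpha| derivatives of one kind and |beta| of the other.  The
    product of the two kinds is the Laplace operator, so phi can be chosen among
    the derivatives of any given test function psi so that D phi = Delta^m psi
    with m = |alpha| + |beta| ([iter_laplacian_wirtinger_word]).  Since Delta^m rho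
    does not vanish, psi can be taken with \int rho Delta^m psi <> 0, and the
    monomial itself is in the closure ([approximable_monomial]).

    The function rho may fail to be Borel measurable.  It is continuous, hence
    measurable, off a null set, and an integral defined as a supremum over simple
    functions does not see null sets ([integral_setD_null]). *)

Local Open Scope complex_scope.

(** * Complex numbers and the plane *)

Section complex_plane.
Context {R : realType}.
Implicit Types (z w : R[i]) (p q : R * R).

Lemma complex_normE z : `|z| = (normc z)%:C.
Proof. by []. Qed.

Lemma normc_ge0 z : 0 <= normc z.
Proof. by case: z => a b; exact: sqrtr_ge0. Qed.

Lemma normc_Re z : `|complex.Re z| <= normc z.
Proof. by rewrite -lecR -complex_normE normc_ge_Re. Qed.

Lemma normc_Im z : `|complex.Im z| <= normc z.
Proof.
case: z => a b /=; rewrite -sqrtr_sqr ler_wsqrtr// lerDr sqr_ge0//.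
Qed.

Lemma normc_real (x : R) : normc x%:C = `|x|.
Proof. by rewrite /= expr0n addr0 sqrtr_sqr. Qed.

Lemma normc_i : normc 'i%C = 1 :> R.
Proof. by rewrite /= expr0n add0r expr1n sqrtr1. Qed.

Lemma normc_ReIm z : normc z <= `|complex.Re z| + `|complex.Im z|.
Proof.
have -> : z = (complex.Re z)%:C + 'i%C * (complex.Im z)%:C by exact: complexE.
apply: le_trans (le_normcD _ _) _; rewrite normcM !normc_real.
by rewrite normc_i mul1r -!complexE.
Qed.

Lemma normcB z w : normc (z - w) = normc (w - z).
Proof. by rewrite -normcN opprB. Qed.

Lemma normc_sum (I : Type) (s : seq I) (F : I -> R[i]) :
  normc (\sum_(i <- s) F i) <= \sum_(i <- s) normc (F i).
Proof.
elim/big_ind2 : _ => [|x1 x2 y1 y2 h1 h2|//]; first by rewrite normc0.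
exact: le_trans (le_normcD _ _) (lerD h1 h2).
Qed.

Lemma nbhs_complexP z (A : set R[i]) :
  nbhs z A <-> exists2 e : R, 0 < e & forall w, normc (z - w) < e -> A w.
Proof.
split.
  move=> /nbhs_ballP[e /= e0 h].
  move: e0; rewrite ltcE /= => /andP[/eqP e2 e1]; exists (complex.Re e) => // w zw.
  apply: h; rewrite -ball_normE /= complex_normE.
  by rewrite ltcE /= e2 eqxx.
move=> [e e0 h]; apply/nbhs_ballP; exists e%:C => /=; first by rewrite ltcR.
by move=> w; rewrite -ball_normE /= complex_normE ltcR => /h.
Qed.

Lemma toCB p q : toC p - toC q = toC (p - q).
Proof. by []. Qed.

Lemma toCD p q : toC p + toC q = toC (p + q).
Proof. by []. Qed.

Definition ofC z : R * R := (complex.Re z, complex.Im z).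

Lemma toC_ofC z : toC (ofC z) = z.
Proof. by case: z. Qed.

Lemma toC_continuous : continuous (@toC R).
Proof.
move=> p A /nbhs_complexP[e e0 h]; apply/nbhs_ballP.
exists (e / 2); first by rewrite /= divr_gt0.
move=> q [/= h1 h2]; apply: h; rewrite toCB.
apply: le_lt_trans (normc_ReIm _) _ => /=.
move: h1 h2; rewrite /ball /= => h1 h2.
by rewrite (splitr e) ltrD.
Qed.

Lemma Re_continuous : continuous (@complex.Re R : R[i] -> R).
Proof.
move=> z A /nbhs_ballP[e /= e0 h]; apply/nbhs_complexP; exists e => // w zw.
apply: h; rewrite /ball /=; apply: le_lt_trans zw.
by apply: le_trans (normc_Re _); case: z w => a b [c d].
Qed.

Lemma Im_continuous : continuous (@complex.Im R : R[i] -> R).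
Proof.
move=> z A /nbhs_ballP[e /= e0 h]; apply/nbhs_complexP; exists e => // w zw.
apply: h; rewrite /ball /=; apply: le_lt_trans zw.
by apply: le_trans (normc_Im _); case: z w => a b [c d].
Qed.

(** The norm of a complex number is itself a complex number, and so is the bound that
    [bounded_near] provides: its real part bounds the real-valued modulus. *)
Lemma locally_boundedP (U : set R[i]) (rho : R[i] -> R[i]) :
  open U -> [locally [bounded rho w | w in U]] ->
  forall z, U z -> exists (e M : R), 0 < e /\
    forall w, normc (z - w) < e -> U w /\ normc (rho w) <= M.
Proof.
move=> oU h z Uz; have := h z Uz; rewrite /bounded_near.
move=> [M [Mr hM]]; have := hM (M + 1).
rewrite ltrDl ltr01 => /(_ isT) /= /nbhs_complexP[e e0 he].
have /nbhs_complexP[e' e'0 he'] : nbhs z U by exact: open_nbhs_nbhs.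
exists (Num.min e e'), (complex.Re (M + 1)); split; first by rewrite lt_min e0.
move=> w; rewrite lt_min => /andP[h1 h2].
split; first exact: he'.
have : (normc (rho w))%:C <= M + 1 by exact: (he w h1 (he' w h2)).
by rewrite lecE => /andP[_].
Qed.

End complex_plane.

(** * Integration on the plane *)

Section lower_integral.
Context d (T : measurableType d) (R : realType) (mu : {measure set T -> \bar R}).
Import HBNNSimple.
Local Open Scope ereal_scope.

(** As f may fail to be measurable, only the simple functions below f are
    available: setting one of them to 0 on N does not change its integral. *)
Lemma ge0_integral_setD_null (D N : set T) (f : T -> \bar R) :
  measurable N -> mu N = 0 -> (forall x, 0 <= f x) ->
  \int[mu]_(x in D) f x = \int[mu]_(x in D `\` N) f x.
Proof.
move=> mN N0 f0; rewrite !ge0_integralE//; apply/eqP; rewrite eq_le.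
have mNc := measurableC mN.
apply/andP; split; apply: ge_ereal_sup => _ [h /= hf <-].
  apply: ereal_sup_ubound; exists (proj_nnsfun h mNc).
    move=> x /=; rewrite -[X in (X)%:E]/((proj_nnsfun h mNc : T -> R) x).
    rewrite -mrestrict; have := hf x; rewrite !patchE in_setD.
    rewrite in_setC; case: (x \in N) => /=; last by rewrite andbT.
    by rewrite andbF.
  rewrite -[X in sintegral mu X]/(proj_nnsfun h mNc : T -> R).
  rewrite -mrestrict -integral_nnsfun//.
  have -> : sintegral mu h = sintegral mu ((h : T -> R) \_ setT).
    by congr sintegral; apply/funext => x; rewrite patchE in_setT.
  rewrite -integral_nnsfun//.
  rewrite [RHS](ge0_negligible_integral mN)// ?setTD//.
  - by apply: measurableT_comp.
  - by move=> x _; rewrite lee_fin.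
apply: ereal_sup_ubound; exists h => // x /=.
apply: le_trans (hf x) _; rewrite !patchE in_setD.
case: (x \in D) => //=; case: (x \in N) => //=.
Qed.

Lemma integral_setD_null (D N : set T) (f : T -> \bar R) :
  measurable N -> mu N = 0 ->
  \int[mu]_(x in D) f x = \int[mu]_(x in D `\` N) f x.
Proof.
move=> mN N0; rewrite integralE [RHS]integralE.
by congr (_ - _); apply: ge0_integral_setD_null.
Qed.

End lower_integral.

Section plane_measure.
Context {R : realType}.
Implicit Types (A : set (R * R)) (p q : R * R).
Local Notation mu := (lebesgue2 R).

Lemma ball_planeP p (e : R) q :
  ball p e q <-> `|p.1 - q.1| < e /\ `|p.2 - q.2| < e.
Proof. by []. Qed.

Lemma ball_planeE p e :
  ball p e = `]p.1 - e, p.1 + e[%classic `*` `]p.2 - e, p.2 + e[%classic.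
Proof.
apply/seteqP; split => -[x y] [/= h1 h2].
  by move: h1 h2; rewrite /ball /= !in_itv/= !ltr_norml => /andP[? ?] /andP[? ?];
    split; apply/andP; split; lra.
split; rewrite /ball /= ltr_norml; move: h1 h2; rewrite /= !in_itv/=;
  by move=> /andP[? ?] /andP[? ?]; apply/andP; split; lra.
Qed.

(** The balls with rational centre and radius form a countable base. *)
Lemma open_plane_measurable A : open A -> measurable A.
Proof.
move=> oA.
pose B (r : rat * rat * rat) : set (R * R) :=
  ball (ratr r.1.1 : R, ratr r.1.2 : R) (ratr r.2 : R).
have -> : A = \bigcup_(r in [set r | B r `<=` A]) B r.
  apply/seteqP; split; last by move=> p [r /= rA /rA].
  move=> [x y] Axy.
  have /nbhs_ballP[e /= e0 eA] : nbhs (x, y) A by exact: open_nbhs_nbhs.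
  have [q1] : exists q : rat, (ratr q : R) \in `]0, (e / 2)[.
    by apply: rat_in_itvoo; rewrite divr_gt0.
  rewrite in_itv/= => /andP[q0 qe].
  have [a1] : exists q : rat, (ratr q : R) \in `](x - ratr q1), (x + ratr q1)[.
    by apply: rat_in_itvoo; lra.
  have [a2] : exists q : rat, (ratr q : R) \in `](y - ratr q1), (y + ratr q1)[.
    by apply: rat_in_itvoo; lra.
  rewrite !in_itv/= => /andP[? ?] /andP[? ?].
  have Bxy : B (a1, a2, q1) (x, y).
    by apply/ball_planeP; rewrite !ltr_norml /=; split; apply/andP; split; lra.
  exists (a1, a2, q1) => //= -[u v] /ball_planeP/=; rewrite !ltr_norml => -[/andP[? ?] /andP[? ?]].
  by apply/eA/ball_planeP; rewrite !ltr_norml/=; split; apply/andP; split; lra.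
rewrite bigcup_mkcond; apply: countable_bigcupT_measurable => // r.
case: ifPn => // _; rewrite /B ball_planeE.
by apply: measurableX; exact: measurable_itv.
Qed.

(** On A, the preimage of an open ray coincides with its interior. *)
Lemma measurable_fun_continuous_at A (f : R * R -> R) :
  measurable A -> (forall p, A p -> {for p, continuous f}) ->
  measurable_fun A f.
Proof.
move=> mA cf; apply: (measurability _ (RGenOInfty.measurableE R)).
move=> _ [_ [a ->] <-].
have -> : A `&` f @^-1` `]a, +oo[ = A `&` (f @^-1` `]a, +oo[)^°.
  apply/seteqP; split => [p [Ap fp]|p [Ap /interior_subset]//].
  split => //; apply: cf => //.
  by apply: open_nbhs_nbhs; split => //; exact: interval_open.
apply: measurableI => //; apply: open_plane_measurable; exact: open_interior.
Qed.

Lemma square_measure (x y h : R) : 0 <= h ->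
  mu (`[x, x + h[%classic `*` `[y, y + h[%classic) = (h * h)%:E.
Proof.
move=> h0; rewrite product_measure1E ?lebesgue_measure_itv //=.
have E (a : R) : lebesgue_measure (`[a, a + h[%classic : set R) = h%:E.
  rewrite lebesgue_measure_itv /= lte_fin ltrDl.
  case: ifPn => hh; first by rewrite -EFinB; congr (_%:E); ring.
  by congr (_%:E); apply/eqP; rewrite eq_le h0 leNgt hh.
transitivity (h%:E * h%:E)%E; last by rewrite EFinM.
by congr (_ * _)%E; exact: E.
Qed.

Lemma bounded_plane_measure A p (r : R) :
  measurable A -> A `<=` ball p r -> (mu A < +oo)%E.
Proof.
move=> mA Ar; have mB : measurable (ball p r).
  by rewrite ball_planeE; apply: measurableX; exact: measurable_itv.
apply: (@le_lt_trans _ _ (mu (ball p r))).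
  by apply: le_measure => //; rewrite inE.
have E (a b : R) : (lebesgue_measure (`]a, b[%classic : set R) < +oo)%E.
  by rewrite lebesgue_measure_itv /=; case: ifPn => _; rewrite -?EFinB ltry.
rewrite ball_planeE product_measure1E; [|exact: measurable_itv..].
apply: lte_mul_pinfty; [exact: measure_ge0| |exact: E].
by rewrite ge0_fin_numE; [exact: E|exact: measure_ge0].
Qed.

End plane_measure.

Section cells.
Context {R : realType}.
Implicit Types (p w c : R * R).

Definition cell (h : R) c : set (R * R) :=
  `[c.1, c.1 + h[%classic `*` `[c.2, c.2 + h[%classic.

Lemma measurable_cell h c : measurable (cell h c).
Proof. by apply: measurableX; exact: measurable_itv. Qed.

Lemma indic_cell h c p :
  \1_(cell h c) p = (c.1 <= p.1 < c.1 + h)%R%:R * (c.2 <= p.2 < c.2 + h)%R%:R :> R.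
Proof.
rewrite indicE /cell; case: p => x y; rewrite in_setX /= !mem_setE /= !in_itv /=.
by rewrite -natrM mulnb.
Qed.

Lemma sum_adjacent_itv (a h x : R) n : 0 <= h ->
  \sum_(j < n) (a + j%:R * h <= x < a + j%:R * h + h)%R%:R =
  (a <= x < a + n%:R * h)%R%:R :> R.
Proof.
move=> h0; elim: n => [|n IH].
  rewrite big_ord0 mul0r addr0; case: (boolP (_ && _)) => // /andP[ax xa].
  by move: (le_lt_trans ax xa); rewrite ltxx.
rewrite big_ord_recr /= IH -natr1 mulrDl mul1r addrA.
have nh : 0 <= n%:R * h by rewrite mulr_ge0.
have [h1|h1] := leP (a + n%:R * h) x.
  have -> : a <= x by apply: le_trans h1; rewrite lerDl.
  by rewrite /= add0r.
have [h2|h2] := leP a x; last by rewrite /= add0r.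
have -> : x < a + n%:R * h + h by apply: lt_le_trans h1 _; rewrite lerDl.
by rewrite /= addr0.
Qed.

Lemma ball_of_cell h c w p : cell h (c + w) p -> ball c h (p - w).
Proof.
case=> /=; rewrite !in_itv/= => /andP[? ?] /andP[? ?].
by apply/ball_planeP => /=; rewrite !ltr_norml; split; apply/andP; split; lra.
Qed.

Lemma ball_untranslate c w p (h : R) : ball c h (p - w) -> ball (c + w) h p.
Proof.
move=> /ball_planeP/=; rewrite !opprB !addrA => -[h1 h2].
by apply/ball_planeP; split.
Qed.

Lemma ball_translate_le c w p (h d d' : R) : ball c h (p - w) ->
  `|w.1| <= d' -> `|w.2| <= d' -> h + d' < d -> ball c d p.
Proof.
move=> /ball_planeP/=; rewrite !ler_norml !ltr_norml.
move=> [/andP[? ?] /andP[? ?]] /andP[? ?] /andP[? ?] ?.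
by apply/ball_planeP; rewrite !ltr_norml; split; apply/andP; split; lra.
Qed.

Lemma itv_of_norm (a b x : R) : 2 * `|a| < b -> `|x| < a -> - `|a| <= x < - `|a| + b.
Proof.
rewrite ltr_norml => ab /andP[? ?]; have := ler_norm a.
by move=> ?; apply/andP; split; lra.
Qed.

Definition corner (a h : R) n (i : 'I_n * 'I_n) : R * R :=
  (a + i.1%:R * h, a + i.2%:R * h).

(** A square cell is a product of intervals, so the sum over the grid is the product
    of two sums over adjacent intervals. *)
Lemma sum_indic_cells (a h : R) n p w : 0 <= h ->
  \sum_(i : 'I_n * 'I_n) \1_(cell h (corner a h i + w)) p =
  (a <= p.1 - w.1 < a + n%:R * h)%R%:R * (a <= p.2 - w.2 < a + n%:R * h)%R%:R :> R.
Proof.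
move=> h0; rewrite -!(sum_adjacent_itv _ _ _ h0) big_distrlr/= pair_bigA /=.
apply: eq_bigr => -[i j] _; rewrite indic_cell /=.
have E (u v b : R) : (u + v <= b < u + v + h) = (u <= b - v < u + h).
  by rewrite lerBrDr ltrBlDr addrAC.
by rewrite !E.
Qed.

End cells.

Section bounded_measurable.
Context d (T : measurableType d) (R : realType) (mu : {measure set T -> \bar R}).
Variables (D : set T) (mD : measurable D) (fD : (mu D < +oo)%E).

(** Bounded measurable functions: an algebra, whose members are integrable on a set
    of finite measure. *)
Definition bmeas (f : T -> R) :=
  measurable_fun D f /\ exists M : R, forall x, D x -> `|f x| <= M.

Lemma bmeas_integrable f : bmeas f -> mu.-integrable D (EFin \o f).
Proof.
move=> [mf [M bf]]; apply: measurable_bounded_integrable => //.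
exists M; split; first exact: num_real.
by move=> x Mx y Dy; exact: le_trans (bf y Dy) (ltW Mx).
Qed.

Lemma bmeas_cst (a : R) : bmeas (cst a).
Proof. by split; [exact: measurable_cst | exists `|a|]. Qed.

Lemma bmeasD f g : bmeas f -> bmeas g -> bmeas (fun x => f x + g x).
Proof.
move=> [mf [M bf]] [mg [N bg]]; split; first exact: measurable_funD.
exists (M + N) => x Dx; apply: le_trans (ler_normD _ _) _.
by rewrite lerD ?bf ?bg.
Qed.

Lemma bmeasM f g : bmeas f -> bmeas g -> bmeas (fun x => f x * g x).
Proof.
move=> [mf [M bf]] [mg [N bg]]; split; first exact: measurable_funM.
by exists (M * N) => x Dx; rewrite normrM ler_pM ?bf ?bg.
Qed.

Lemma bmeasZ (a : R) f : bmeas f -> bmeas (fun x => a * f x).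
Proof. by move=> bf; apply: bmeasM => //; exact: bmeas_cst. Qed.

Lemma bmeasN f : bmeas f -> bmeas (fun x => - f x).
Proof.
move=> bf; rewrite (_ : (fun x => - f x) = fun x => -1 * f x); first exact: bmeasZ.
by apply/funext => x; rewrite mulN1r.
Qed.

Lemma bmeas_indic A : measurable A -> bmeas (\1_A : T -> R).
Proof.
move=> mA; split; first exact: measurable_funTS.
by exists 1 => x _; rewrite indicE; case: (_ \in _); rewrite /= ?normr1 ?normr0.
Qed.

Definition cbmeas (F : T -> R[i]) :=
  bmeas (fun x => complex.Re (F x)) /\ bmeas (fun x => complex.Im (F x)).

Lemma cbmeasD F G : cbmeas F -> cbmeas G -> cbmeas (fun x => F x + G x).
Proof.
have reD (z w : R[i]) : complex.Re (z + w) = complex.Re z + complex.Re w.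
  by case: z w => a b [].
have imD (z w : R[i]) : complex.Im (z + w) = complex.Im z + complex.Im w.
  by case: z w => a b [].
move=> [F1 F2] [G1 G2]; split.
  by under eq_fun do rewrite reD; exact: bmeasD.
by under eq_fun do rewrite imD; exact: bmeasD.
Qed.

Lemma cbmeasM F G : cbmeas F -> cbmeas G -> cbmeas (fun x => F x * G x).
Proof.
have reM (z w : R[i]) : complex.Re (z * w) =
    complex.Re z * complex.Re w + - (complex.Im z * complex.Im w).
  by case: z w => a b [].
have imM (z w : R[i]) : complex.Im (z * w) =
    complex.Re z * complex.Im w + complex.Im z * complex.Re w.
  by case: z w => a b [].
move=> [F1 F2] [G1 G2]; split.
  under eq_fun do rewrite reM; apply: bmeasD; first exact: bmeasM.
  by apply/bmeasN; exact: bmeasM.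
by under eq_fun do rewrite imM; apply: bmeasD; exact: bmeasM.
Qed.

Lemma cbmeas_cst (c : R[i]) : cbmeas (cst c).
Proof. by split; exact: bmeas_cst. Qed.

Lemma cbmeasZ (c : R[i]) F : cbmeas F -> cbmeas (fun x => c * F x).
Proof. by move=> bF; apply: cbmeasM => //; exact: cbmeas_cst. Qed.

Lemma cbmeas_indic A : measurable A -> cbmeas (fun x => (\1_A x : R)%:C).
Proof. by move=> mA; split; [exact: bmeas_indic | exact: bmeas_cst]. Qed.

Lemma cbmeas_sum (I : Type) (s : seq I) (F : I -> T -> R[i]) :
  (forall i, cbmeas (F i)) -> cbmeas (fun x => \sum_(i <- s) F i x).
Proof.
move=> bF; elim: s => [|i s IH].
  by under eq_fun do rewrite big_nil; exact: cbmeas_cst.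
by under eq_fun do rewrite big_cons; exact: cbmeasD.
Qed.

Definition cint (F : T -> R[i]) : R[i] :=
  (\int[mu]_(x in D) complex.Re (F x)) +i* (\int[mu]_(x in D) complex.Im (F x)).

Lemma eq_cint F G : (forall x, D x -> F x = G x) -> cint F = cint G.
Proof.
by move=> FG; rewrite /cint; congr (_ +i* _);
  apply: eq_Rintegral => x /set_mem /FG ->.
Qed.

Lemma cintD F G : cbmeas F -> cbmeas G ->
  cint (fun x => F x + G x) = cint F + cint G.
Proof.
move=> [F1 F2] [G1 G2]; rewrite /cint.
transitivity ((\int[mu]_(x in D) complex.Re (F x) + \int[mu]_(x in D) complex.Re (G x)) +i*
   (\int[mu]_(x in D) complex.Im (F x) + \int[mu]_(x in D) complex.Im (G x))) => //.
rewrite -!RintegralD//; try exact: bmeas_integrable.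
by congr (_ +i* _); apply: eq_Rintegral => x _; case: (F x) (G x) => a b [].
Qed.

Lemma cintZ (c : R[i]) F : cbmeas F -> cint (fun x => c * F x) = c * cint F.
Proof.
case: c => a b [F1 F2]; rewrite /cint.
transitivity ((a * (\int[mu]_(x in D) complex.Re (F x)) -
    b * (\int[mu]_(x in D) complex.Im (F x))) +i*
   (a * (\int[mu]_(x in D) complex.Im (F x)) +
    b * (\int[mu]_(x in D) complex.Re (F x)))) => //.
have i1 := bmeas_integrable F1; have i2 := bmeas_integrable F2.
rewrite -!RintegralZl// -RintegralB//; try exact: bmeas_integrable (bmeasZ _ _).
rewrite -RintegralD//; try exact: bmeas_integrable (bmeasZ _ _).
by congr (_ +i* _); apply: eq_Rintegral => x _; case: (F x).
Qed.

Lemma cint_sum (I : Type) (s : seq I) (F : I -> T -> R[i]) :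
  (forall i, cbmeas (F i)) ->
  cint (fun x => \sum_(i <- s) F i x) = \sum_(i <- s) cint (F i).
Proof.
move=> bF; elim: s => [|i s IH].
  rewrite big_nil (@eq_cint _ (fun x => 0 * 0)).
    by rewrite (cintZ 0 (cbmeas_cst 0)) mul0r.
  by move=> x _; rewrite big_nil mul0r.
rewrite big_cons -IH -cintD//; last exact: cbmeas_sum.
by apply: eq_cint => x _; rewrite big_cons.
Qed.

(** The factor 2 comes from estimating real and imaginary parts separately. *)
Lemma normc_cint F (b : T -> R) : cbmeas F -> bmeas b ->
  (forall x, D x -> normc (F x) <= b x) ->
  normc (cint F) <= 2 * \int[mu]_(x in D) b x.
Proof.
move=> [F1 F2] bb Fb; apply: le_trans (normc_ReIm _) _.
rewrite /cint /= mulr_natl mulr2n; apply: lerD.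
  apply: le_trans (le_normr_Rintegral mD (bmeas_integrable F1)) _.
  apply: le_Rintegral => //; [|exact: bmeas_integrable|].
    by apply: integrable_norm; exact: bmeas_integrable.
  by move=> x Dx; exact: le_trans (normc_Re _) (Fb x Dx).
apply: le_trans (le_normr_Rintegral mD (bmeas_integrable F2)) _.
apply: le_Rintegral => //; [|exact: bmeas_integrable|].
  by apply: integrable_norm; exact: bmeas_integrable.
by move=> x Dx; exact: le_trans (normc_Im _) (Fb x Dx).
Qed.

Lemma cint_indic A : measurable A ->
  cint (fun x => (\1_A x : R)%:C) = (fine (mu (A `&` D)))%:C.
Proof.
move=> mA; rewrite /cint /= Rintegral_cst// mul0r; congr (_ +i* _).
by rewrite /Rintegral integral_indic.
Qed.

End bounded_measurable.

(** * Differential calculus on the plane *)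

Section plane_calculus.
Context {R : realType}.
Implicit Types (f g : R * R -> R) (p q v : R * R) (K : set (R * R)).

(** Compactness gives a radius valid around all points of K; two points off K have
    equal values. *)
Lemma compact_support_uniform_continuous f K : compact K -> continuous f ->
  (forall p, ~ K p -> f p = 0) -> forall e, 0 < e ->
  exists2 eta : R, 0 < eta & forall p q, ball p eta q -> `|f p - f q| < e.
Proof.
move=> cK cf f0 e e0.
pose P (eta : R) p := forall q, ball p eta q -> `|f p - f q| < e.
have : \forall eta \near (0 : R)^'+, K `<=` P eta.
  move/compact_near_coveringP : cK; apply => p Kp.
  have /nbhs_ballP[d /= d0 hd] : nbhs p (f @^-1` ball (f p) (e / 2)).
    by apply: cf; apply: nbhsx_ballx; rewrite divr_gt0.
  have d20 : 0 < d / 2 by rewrite divr_gt0.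
  exists (ball p (d / 2), [set x | x < d / 2]).
    split; first exact: nbhsx_ballx.
    exact: nbhs_right_lt.
  move=> [p' eta] /= [pp' etad] q p'q.
  have h1 : ball (f p) (e / 2) (f p').
    by apply: hd; apply: le_ball pp'; rewrite ler_pdivrMr// ler_peMr ?(ltW d0)// ler1n.
  have h2 : ball (f p) (e / 2) (f q).
    apply: hd; rewrite (splitr d); apply: ball_triangle pp' _.
    exact: le_ball (ltW etad) _ p'q.
  have := ball_triangle (ball_sym h1) h2.
  by rewrite -splitr.
move=> KP'; have [eta [KP eta0]] : exists eta, K `<=` P eta /\ 0 < eta.
  apply: (@filter_ex _ (0 : R)^'+); apply: filterI => //; exact: nbhs_right_gt.
exists eta => // p q pq.
have [Kp|nKp] := pselect (K p); first exact: KP.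
have [Kq|nKq] := pselect (K q); first by rewrite distrC; apply: KP => //; exact: ball_sym.
by rewrite !f0// subrr normr0.
Qed.

Lemma compact_support_bounded f K : compact K -> continuous f ->
  (forall p, ~ K p -> f p = 0) -> exists G : R, forall p, `|f p| <= G.
Proof.
move=> cK cf f0.
have : \forall G \near +oo, K `<=` [set p | `|f p| <= G].
  move/compact_near_coveringP : cK; apply => p Kp.
  have h : \forall p' \near p, `|f p - f p'| < 1.
    exact: (cf p _ (nbhsx_ballx (f p) 1 ltr01)).
  exists ([set p' | `|f p - f p'| < 1], [set G | `|f p| + 1 < G]).
    by split => //=; exact: nbhs_pinfty_gt.
  move=> [p' G] /= [h1 h2]; apply: le_trans (ltW h2).
  rewrite -lerBlDl; apply: le_trans (ltW h1); rewrite distrC.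
  exact: lerB_dist.
move=> KG'; have [G [KG G0]] : exists G : R, K `<=` [set p | `|f p| <= G] /\ 0 <= G.
  apply: (@filter_ex _ (+oo_R)); apply: filterI => //.
  by apply: nbhs_pinfty_ge; exact: num_real.
exists G => p; have [Kp|nKp] := pselect (K p); first exact: KG.
by rewrite f0// normr0.
Qed.

Lemma is_derive_line f v p (t : R) : (forall q, derivable f q v) ->
  is_derive t 1 (fun s : R => f (s *: v + p)) ('D_v f (t *: v + p)).
Proof.
move=> df.
have E : (fun h : R => h^-1 *:
      (((fun s : R => f (s *: v + p)) \o shift t) (h *: 1) - f (t *: v + p))) =
    (fun h : R => h^-1 *: ((f \o shift (t *: v + p)) (h *: v) - f (t *: v + p))).
  by apply/funext => h /=; rewrite scalerDl addrA [h *: 1]mulr1.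
split; first by rewrite /derivable E; exact: df.
by rewrite /derive E.
Qed.

Lemma mean_value_line f v p (a : R) : (forall q, derivable f q v) ->
  exists2 c : R, `|c| <= `|a| & f (a *: v + p) - f p = a * 'D_v f (c *: v + p).
Proof.
move=> df; pose F s := f (s *: v + p).
have dF (t : R) : is_derive t 1 F ('D_v f (t *: v + p)) by exact: is_derive_line.
have cF : continuous F.
  move=> t; apply/differentiable_continuous/derivable1_diffP.
  by have [] := dF t.
have F0 : F 0 = f p by rewrite /F scale0r add0r.
have [a0|a0] := leP 0 a.
  have [c ci Fc] := MVT_segment a0 (fun t _ => dF t) (continuous_subspaceT cF).
  exists c; last by rewrite -F0 [LHS]Fc subr0 mulrC.
  by move: ci; rewrite in_itv/= => /andP[? ?]; rewrite !ger0_norm.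
have [c ci Fc] := MVT_segment (ltW a0) (fun t _ => dF t) (continuous_subspaceT cF).
exists c.
  by move: ci; rewrite in_itv/= => /andP[? ?]; rewrite !ler0_norm ?lerN2// ltW.
by rewrite -F0 -[LHS]opprB [X in - X]Fc sub0r mulrN opprK mulrC.
Qed.

(** The increment along v is an increment along each axis in turn.  The mean value
    theorem turns both into values of a partial derivative at points that differ from p
    by at most s * r in each coordinate, and uniform continuity applies. *)
Lemma C1_uniform_difference_quotient g : Ck 1 g ->
  (forall e, 0 < e -> exists2 eta : R, 0 < eta &
     forall p q, ball p eta q -> `|'D_(dirx R) g p - 'D_(dirx R) g q| < e) ->
  (forall e, 0 < e -> exists2 eta : R, 0 < eta &
     forall p q, ball p eta q -> `|'D_(diry R) g p - 'D_(diry R) g q| < e) ->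
  forall r e : R, 0 < r -> 0 < e -> exists2 s0 : R, 0 < s0 &
  forall s p v, 0 < s < s0 -> `|v.1| <= r -> `|v.2| <= r ->
    `|(g (p + s *: v) - g p) / s -
      (v.1 * 'D_(dirx R) g p + v.2 * 'D_(diry R) g p)| <= e.
Proof.
move=> [cg dg _ _] ux uy r e r0 e0.
have e'0 : 0 < e / (2 * r) by rewrite divr_gt0// mulr_gt0.
have [ex ex0 hx] := ux _ e'0; have [ey ey0 hy] := uy _ e'0.
exists (Num.min ex ey / (2 * r)); first by rewrite divr_gt0 ?lt_min ?ex0// mulr_gt0.
move=> s p v /andP[s0]; rewrite ltr_pdivlMr ?mulr_gt0// lt_min => /andP[sx sy] v1 v2.
have [c hc Ec] := @mean_value_line g (dirx R) (p + (0, s * v.2)) (s * v.1) (fun q => (dg q).1).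
have [c' hc' Ec'] := @mean_value_line g (diry R) p (s * v.2) (fun q => (dg q).2).
have E1 : (s * v.1) *: dirx R + (p + (0, s * v.2)) = p + s *: v.
  by apply: injective_projections; rewrite /= /GRing.scale /=; ring.
have E2 : (s * v.2) *: diry R + p = p + (0, s * v.2).
  by apply: injective_projections; rewrite /= /GRing.scale /=; ring.
rewrite E1 in Ec; rewrite E2 in Ec'.
set A := 'D_ _ g _ in Ec; set B := 'D_ _ g _ in Ec'.
have sv u : `|u| <= r -> `|s * u| <= s * r.
  by move=> ur; rewrite normrM gtr0_norm// ler_pM2l.
have s2 : s * r < s * (2 * r) by rewrite ltr_pM2l//; lra.
have hA : `|A - 'D_(dirx R) g p| <= e / (2 * r).
  apply/ltW; rewrite distrC; apply: hx; apply/ball_planeP.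
  have h1 := le_lt_trans (le_trans hc (sv _ v1)) (lt_trans s2 sx).
  have h2 := le_lt_trans (sv _ v2) (lt_trans s2 sx).
  split; rewrite /= /GRing.scale /=.
    by rewrite [X in `|X|](_ : _ = - c) ?normrN//; ring.
  by rewrite [X in `|X|](_ : _ = - (s * v.2)) ?normrN//; ring.
have hB : `|B - 'D_(diry R) g p| <= e / (2 * r).
  apply/ltW; rewrite distrC; apply: hy; apply/ball_planeP.
  have h1 := le_lt_trans (le_trans hc' (sv _ v2)) (lt_trans s2 sy).
  split; rewrite /= /GRing.scale /=.
    by rewrite [X in `|X|](_ : _ = 0) ?normr0//; ring.
  by rewrite [X in `|X|](_ : _ = - c') ?normrN//; ring.
have Eg : g (p + s *: v) - g p = s * v.1 * A + s * v.2 * B by rewrite -Ec -Ec'; ring.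
rewrite {}Eg; clearbody A B; move: hA hB; clear -e0 r0 s0 v1 v2.
move: ('D_(dirx R) g p) ('D_(diry R) g p) => a b hA hB.
have -> : (s * v.1 * A + s * v.2 * B) / s - (v.1 * a + v.2 * b) =
    v.1 * (A - a) + v.2 * (B - b) by field; exact: lt0r_neq0.
apply: le_trans (ler_normD _ _) _; rewrite !normrM.
rewrite (_ : e = r * (e / (2 * r)) + r * (e / (2 * r))); last by field; exact: lt0r_neq0.
by rewrite lerD ?ler_pM.
Qed.

Lemma is_derive_translate g w v p : derivable g (p + w) v ->
  is_derive p v (fun q => g (q + w)) ('D_v g (p + w)).
Proof.
move=> dg.
have E : (fun h : R => h^-1 *: (((fun q => g (q + w)) \o shift p) (h *: v) - g (p + w))) =
    (fun h : R => h^-1 *: ((g \o shift (p + w)) (h *: v) - g (p + w))).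
  by apply/funext => h /=; rewrite addrA.
by split; [rewrite /derivable E | rewrite /derive E].
Qed.

(** The left-hand side is the increment along u of the increment of g along v: the mean
    value theorem is applied first in the direction u, then in the direction v. *)
Lemma second_difference_mean_value g u v p (h : R) : (forall q, derivable g q u) ->
  (forall q, derivable ('D_u g) q v) ->
  exists c d : R, [/\ `|c| <= `|h|, `|d| <= `|h| &
    g (p + h *: u + h *: v) - g (p + h *: u) - g (p + h *: v) + g p =
    h * (h * 'D_v ('D_u g) (p + c *: u + d *: v))].
Proof.
move=> du dv; pose phi q := g (q + h *: v) - g q.
have dphi q : is_derive q u phi ('D_u g (q + h *: v) - 'D_u g q).
  have d1 : is_derive q u (fun q => g (q + h *: v)) ('D_u g (q + h *: v)).
    exact: is_derive_translate.
  have d2 : is_derive q u g ('D_u g q) by split.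
  exact: is_deriveB.
have [c hc Ec] := @mean_value_line phi u p h (fun q => @ex_derive _ _ _ _ _ _ _ (dphi q)).
have [d hd Ed] := @mean_value_line ('D_u g) v (c *: u + p) h dv.
exists c, d; split => //.
rewrite [p + c *: u]addrC [c *: u + p + _]addrC -Ed [h *: v + _]addrC.
rewrite -(@derive_val _ _ _ _ _ _ _ (dphi _)) -Ec /phi [h *: u + p]addrC.
by rewrite opprB addrA addrAC.
Qed.

Lemma second_difference_limits_agree g (gxy gyx : R * R -> R) :
  continuous gxy -> continuous gyx ->
  (forall p (h : R), exists c d : R, [/\ `|c| <= `|h|, `|d| <= `|h| &
    g (p + h *: dirx R + h *: diry R) - g (p + h *: dirx R) - g (p + h *: diry R) + g p =
    h * (h * gxy (p + c *: dirx R + d *: diry R))]) ->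
  (forall p (h : R), exists c d : R, [/\ `|c| <= `|h|, `|d| <= `|h| &
    g (p + h *: diry R + h *: dirx R) - g (p + h *: diry R) - g (p + h *: dirx R) + g p =
    h * (h * gyx (p + c *: diry R + d *: dirx R))]) ->
  gxy = gyx.
Proof.
move=> cgxy cgyx dxy dyx; apply/funext => p; apply/eqP.
rewrite -subr_eq0 -normr_le0.
apply/ler_addgt0Pr => e e0; rewrite add0r.
have e20 : 0 < e / 2 by rewrite divr_gt0.
have /nbhs_ballP[e1 /= e10 h1] := cgxy p _ (nbhsx_ballx _ (e / 2) e20).
have /nbhs_ballP[e2 /= e20' h2] := cgyx p _ (nbhsx_ballx _ (e / 2) e20).
pose h := Num.min e1 e2 / 2.
have h0 : 0 < h by rewrite divr_gt0// lt_min e10.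
have he1 : h < e1 by rewrite ltr_pdivrMr// gt_min; apply/orP; left; lra.
have he2 : h < e2 by rewrite ltr_pdivrMr// gt_min; apply/orP; right; lra.
have [c [d [hc hd]]] := dxy p h; have [c' [d' [hc' hd']]] := dyx p h.
rewrite (gtr0_norm h0) in hc hd hc' hd'; rewrite [p + _ + h *: dirx R]addrAC.
move=> E2 E1.
have b1 : ball p e1 (p + c *: dirx R + d *: diry R).
  apply/ball_planeP; split; rewrite /= /GRing.scale /=.
    have -> : p.1 - (p.1 + c * 1 + d * 0) = - c by ring.
    by rewrite normrN (le_lt_trans hc).
  have -> : p.2 - (p.2 + c * 0 + d * 1) = - d by ring.
  by rewrite normrN (le_lt_trans hd).
have b2 : ball p e2 (p + c' *: diry R + d' *: dirx R).
  apply/ball_planeP; split; rewrite /= /GRing.scale /=.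
    have -> : p.1 - (p.1 + c' * 0 + d' * 1) = - d' by ring.
    by rewrite normrN (le_lt_trans hd').
  have -> : p.2 - (p.2 + c' * 1 + d' * 0) = - c' by ring.
  by rewrite normrN (le_lt_trans hc').
have E3 : gxy (p + c *: dirx R + d *: diry R) = gyx (p + c' *: diry R + d' *: dirx R).
  apply: (@mulfI _ h); first exact: lt0r_neq0.
  apply: (@mulfI _ h); first exact: lt0r_neq0.
  by rewrite -E1 -E2; ring.
have H1 := h1 _ b1; have H2 := h2 _ b2; rewrite /= E3 in H1.
have := ball_triangle H1 (ball_sym H2).
by rewrite -splitr => /ltW.
Qed.

(** Schwarz: by the mean value theorem, the two mixed derivatives are limits of the same
    second difference, which is symmetric in the two directions. *)
Lemma mixed_partials_commute g : Ck 2 g ->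
  'D_(diry R) ('D_(dirx R) g) = 'D_(dirx R) ('D_(diry R) g).
Proof.
move=> [cg dg [cgx dgx _ cgxy] [cgy dgy cgyx _]].
apply: (second_difference_limits_agree cgxy cgyx) => p h.
  by apply: second_difference_mean_value => q; [exact: (dg q).1 | exact: (dgx q).2].
by apply: second_difference_mean_value => q; [exact: (dg q).2 | exact: (dgy q).1].
Qed.

End plane_calculus.

Local Opaque dirx diry.

Section smooth_functions.
Context {R : realType}.
Implicit Types (f g : R * R -> R) (p q v : R * R) (K : set (R * R)).
Implicit Types (phi psi : R * R -> R[i]).

Lemma is_derive_lin f g (a b : R) p v : derivable f p v -> derivable g p v ->
  is_derive p v (fun q => a * f q + b * g q) (a * 'D_v f p + b * 'D_v g p).
Proof.
move=> df dg.
have d1 : is_derive p v f ('D_v f p) by split.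
have d2 : is_derive p v g ('D_v g p) by split.
have -> : (fun q => a * f q + b * g q) = a \*: f + b \*: g by [].
exact: is_deriveD.
Qed.

Lemma derive_lin f g (a b : R) v : (forall p, derivable f p v) -> (forall p, derivable g p v) ->
  'D_v (fun q => a * f q + b * g q) = fun p => a * 'D_v f p + b * 'D_v g p.
Proof.
by move=> df dg; apply/funext => p; have [_] := is_derive_lin a b (df p) (dg p).
Qed.

Lemma Ck_lin k (a b : R) f g : Ck k f -> Ck k g -> Ck k (fun q => a * f q + b * g q).
Proof.
have cl (u w : R * R -> R) : continuous u -> continuous w ->
    continuous (fun q => a * u q + b * w q).
  move=> cu cw p; apply: cvgD.
    by apply: cvgM; [exact: cvg_cst | exact: cu].
  by apply: cvgM; [exact: cvg_cst | exact: cw].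
elim: k f g => [|k IH] f g /=; first exact: cl.
move=> [cf df fx fy] [cg dg gx gy].
have fdx p := (df p).1; have fdy p := (df p).2.
have gdx p := (dg p).1; have gdy p := (dg p).2.
split; first exact: cl.
- move=> p; split.
    by have [] := is_derive_lin a b (fdx p) (gdx p).
  by have [] := is_derive_lin a b (fdy p) (gdy p).
- by rewrite (derive_lin a b fdx gdx); exact: IH.
- by rewrite (derive_lin a b fdy gdy); exact: IH.
Qed.

(** The two directions in which [Ck] provides derivatives. *)
Definition axis v := v = dirx R \/ v = diry R.

Lemma axis_x : axis (dirx R). Proof. by left. Qed.
Lemma axis_y : axis (diry R). Proof. by right. Qed.

Lemma csmooth_derivable phi v p : csmooth phi -> axis v ->
  derivable (fun q => complex.Re (phi q)) p v /\
  derivable (fun q => complex.Im (phi q)) p v.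
Proof.
by move=> /(_ 1%N) [[_ d1 _ _] [_ d2 _ _]] [] ->; split;
  have [] := d1 p; have [] := d2 p.
Qed.

Lemma csmooth_cpartial phi v : csmooth phi -> axis v -> csmooth (cpartial v phi).
Proof. by move=> s [] -> k; have [[_ _ a b] [_ _ c d]] := s k.+1; split. Qed.

Let ReM (z w : R[i]) : complex.Re (z * w) =
  complex.Re z * complex.Re w + (- complex.Im z) * complex.Im w.
Proof. by case: z w => a b [c d] /=; rewrite mulNr. Qed.
Let ImM (z w : R[i]) : complex.Im (z * w) =
  complex.Re z * complex.Im w + complex.Im z * complex.Re w.
Proof. by case: z w => a b []. Qed.
Let ReD (z w : R[i]) : complex.Re (z + w) = 1 * complex.Re z + 1 * complex.Re w.
Proof. by case: z w => a b [c d] /=; rewrite !mul1r. Qed.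
Let ImD (z w : R[i]) : complex.Im (z + w) = 1 * complex.Im z + 1 * complex.Im w.
Proof. by case: z w => a b [c d] /=; rewrite !mul1r. Qed.

Lemma csmoothD phi psi : csmooth phi -> csmooth psi ->
  csmooth (fun p => phi p + psi p).
Proof.
move=> s1 s2 k; have [a1 b1] := s1 k; have [a2 b2] := s2 k.
split; [under eq_fun do rewrite ReD | under eq_fun do rewrite ImD];
  exact: Ck_lin.
Qed.

Lemma csmoothZ (c : R[i]) phi : csmooth phi -> csmooth (fun p => c * phi p).
Proof.
move=> s1 k; have [a1 b1] := s1 k.
split; [under eq_fun do rewrite ReM | under eq_fun do rewrite ImM];
  exact: Ck_lin.
Qed.

Lemma cpartialD v phi psi : axis v -> csmooth phi -> csmooth psi ->
  cpartial v (fun p => phi p + psi p) = fun p => cpartial v phi p + cpartial v psi p.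
Proof.
move=> av s1 s2; apply/funext => p.
have [d1 d2] := csmooth_derivable p s1 av; have [d3 d4] := csmooth_derivable p s2 av.
have [_ e1] := is_derive_lin 1 1 d1 d3; have [_ e2] := is_derive_lin 1 1 d2 d4.
rewrite /cpartial (eq_fun (fun q => ReD (phi q) (psi q))).
by rewrite (eq_fun (fun q => ImD (phi q) (psi q))) e1 e2 !mul1r.
Qed.

Lemma cpartialZ v (c : R[i]) phi : axis v -> csmooth phi ->
  cpartial v (fun p => c * phi p) = fun p => c * cpartial v phi p.
Proof.
move=> av s1; apply/funext => p.
have [d1 d2] := csmooth_derivable p s1 av.
have [_ e1] := is_derive_lin (complex.Re c) (- complex.Im c) d1 d2.
have [_ e2] := is_derive_lin (complex.Re c) (complex.Im c) d2 d1.
rewrite /cpartial (eq_fun (fun q => ReM c (phi q))).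
rewrite (eq_fun (fun q => ImM c (phi q))) e1 e2.
by case: c {e1 e2} => a b; rewrite /= mulNr.
Qed.

Lemma cpartialC phi : csmooth phi ->
  cpartial (diry R) (cpartial (dirx R) phi) = cpartial (dirx R) (cpartial (diry R) phi).
Proof.
move=> s; have [c1 c2] := s 2.
apply/funext => p.
have E1 := congr1 (fun f => f p) (mixed_partials_commute c1).
have E2 := congr1 (fun f => f p) (mixed_partials_commute c2).
exact: (congr2 (@Complex R) E1 E2).
Qed.

Lemma cpartial_locally0 v phi p : (\forall q \near p, phi q = 0) ->
  cpartial v phi p = 0.
Proof.
move=> h; have E (u : R[i] -> R) : u 0 = 0 -> 'D_v (fun q => u (phi q)) p = 0.
  move=> u0; rewrite -(derive_cst (0 : R) p v).
  by apply: near_eq_derive; apply: filterS h => q ->.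
by rewrite /cpartial !E.
Qed.

(** When K is closed this space is stable under differentiation, unlike the set of
    functions with a given topological support. *)
Definition smooth_in K phi := csmooth phi /\ forall p, ~ K p -> phi p = 0.

Lemma smooth_inD K phi psi : smooth_in K phi -> smooth_in K psi ->
  smooth_in K (fun p => phi p + psi p).
Proof.
move=> [s1 z1] [s2 z2]; split; first exact: csmoothD.
by move=> p Kp; rewrite z1// z2// addr0.
Qed.

Lemma smooth_inZ K c phi : smooth_in K phi -> smooth_in K (fun p => c * phi p).
Proof.
move=> [s1 z1]; split; first exact: csmoothZ.
by move=> p Kp; rewrite z1// mulr0.
Qed.

Lemma smooth_in_cpartial K v phi : closed K -> axis v -> smooth_in K phi ->
  smooth_in K (cpartial v phi).
Proof.
move=> cK av [s1 z1]; split; first exact: csmooth_cpartial.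
move=> p Kp; apply: cpartial_locally0.
have : nbhs p (~` K) by apply: open_nbhs_nbhs; split => //; exact: closed_openC.
by apply: filterS => q /z1.
Qed.

Definition unit_i (b : bool) : R[i] := if b then - 'i else 'i.

(** Twice d/dz if b holds, twice d/dz-bar otherwise. *)
Definition wirtinger (b : bool) phi : R * R -> R[i] :=
  fun p => cpartial (dirx R) phi p + unit_i b * cpartial (diry R) phi p.

Definition laplacian phi : R * R -> R[i] :=
  fun p => cpartial (dirx R) (cpartial (dirx R) phi) p +
           cpartial (diry R) (cpartial (diry R) phi) p.

Lemma smooth_in_wirtinger K b phi : closed K -> smooth_in K phi ->
  smooth_in K (wirtinger b phi).
Proof.
move=> cK s; apply: smooth_inD; last apply: smooth_inZ.
  by apply: smooth_in_cpartial => //; exact: axis_x.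
by apply: smooth_in_cpartial => //; exact: axis_y.
Qed.

Lemma smooth_in_laplacian K phi : closed K -> smooth_in K phi ->
  smooth_in K (laplacian phi).
Proof.
by move=> cK s; apply: smooth_inD; do 2 (apply: smooth_in_cpartial => //;
  rewrite /axis; auto).
Qed.

(** The cross terms cancel since mixed partial derivatives commute. *)
Lemma wirtinger_laplacian b phi : csmooth phi ->
  wirtinger b (wirtinger (~~ b) phi) = laplacian phi.
Proof.
move=> s; have sx := csmooth_cpartial s axis_x; have sy := csmooth_cpartial s axis_y.
have syc c := csmoothZ c sy.
rewrite /wirtinger (cpartialD axis_x sx (syc _)) (cpartialD axis_y sx (syc _)).
rewrite (cpartialZ _ axis_x sy) (cpartialZ _ axis_y sy) (cpartialC s).
apply/funext => p; rewrite /laplacian.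
have e1 : unit_i b + unit_i (~~ b) = 0 by case: b; rewrite /= ?addNr ?subrr.
have e2 : unit_i b * unit_i (~~ b) = 1.
  by clear e1; case: b; rewrite /= ?mulNr ?mulrN -expr2 sqr_i opprK.
rewrite mulrDr mulrA e2 mul1r addrA; congr (_ + _).
by rewrite -addrA -mulrDl [X in X * _]addrC e1 mul0r addr0.
Qed.

Lemma laplacianD phi psi : csmooth phi -> csmooth psi ->
  laplacian (fun p => phi p + psi p) = fun p => laplacian phi p + laplacian psi p.
Proof.
move=> s1 s2; rewrite /laplacian.
rewrite (cpartialD axis_x s1 s2) (cpartialD axis_y s1 s2).
rewrite (cpartialD axis_x (csmooth_cpartial s1 axis_x) (csmooth_cpartial s2 axis_x)).
rewrite (cpartialD axis_y (csmooth_cpartial s1 axis_y) (csmooth_cpartial s2 axis_y)).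
by apply/funext => p; exact: addrACA.
Qed.

Lemma csmooth_laplacian phi : csmooth phi -> csmooth (laplacian phi).
Proof.
by move=> s; apply: csmoothD; do 2 (apply: csmooth_cpartial => //; rewrite /axis; auto).
Qed.

Lemma csmooth_iter_laplacian m phi : csmooth phi -> csmooth (iter m laplacian phi).
Proof. by move=> s; elim: m => //= m; exact: csmooth_laplacian. Qed.

Lemma iter_laplacianD m phi psi : csmooth phi -> csmooth psi ->
  iter m laplacian (fun p => phi p + psi p) =
  fun p => iter m laplacian phi p + iter m laplacian psi p.
Proof.
move=> s1 s2; elim: m => //= m ->.
by rewrite laplacianD//; exact: csmooth_iter_laplacian.
Qed.

Lemma smooth_in_iter_laplacian K m phi : closed K -> smooth_in K phi ->
  smooth_in K (iter m laplacian phi).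
Proof. by move=> cK s; elim: m => //= m; exact: smooth_in_laplacian. Qed.

Definition wirtinger_word (w : seq bool) phi := foldr wirtinger phi w.

Lemma csmooth_wirtinger b phi : csmooth phi -> csmooth (wirtinger b phi).
Proof.
move=> s; apply: csmoothD; last apply: csmoothZ;
  by apply: csmooth_cpartial => //; rewrite /axis; auto.
Qed.

(** Factoring the Laplacian in either order, both sides are the product of the
    Wirtinger derivatives b, ~~ b, b. *)
Lemma wirtinger_laplacianC b phi : csmooth phi ->
  wirtinger b (laplacian phi) = laplacian (wirtinger b phi).
Proof.
move=> s; rewrite -(@wirtinger_laplacian (~~ b) phi)// negbK.
by rewrite wirtinger_laplacian//; exact: csmooth_wirtinger.
Qed.

(** Each letter of w is completed to a Laplacian by the opposite letter: psi is the image
    of phi under the opposite word. *)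
Lemma iter_laplacian_wirtinger_word K (w : seq bool) phi : closed K -> smooth_in K phi ->
  exists2 psi, smooth_in K psi &
    wirtinger_word w psi = iter (size w) laplacian phi.
Proof.
move=> cK; elim: w phi => [|b w IH] phi s; first by exists phi.
have [psi s' E] := IH _ (smooth_in_wirtinger (~~ b) cK s).
exists psi => //=; rewrite E.
have [s1 _] := s; have s2 := csmooth_wirtinger (~~ b) s1.
rewrite -iterS iterSr -(@wirtinger_laplacian b phi)//.
elim: (size w) (wirtinger (~~ b) phi) s2 => //= n IHn chi sc.
rewrite wirtinger_laplacianC ?IHn//; exact: csmooth_iter_laplacian.
Qed.

End smooth_functions.

Section wirtinger_identities.
Context {R : realType}.
Implicit Types (z w X Y h : R[i]).

Lemma normc_quotient_le z w (s x y x1 x2 y1 y2 e : R) :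
  `|(complex.Re z - complex.Re w) / s - (x * x1 + y * y1)| <= e / 2 ->
  `|(complex.Im z - complex.Im w) / s - (x * x2 + y * y2)| <= e / 2 ->
  normc ((s^-1)%:C * (z + -1 * w) + -1 * (x%:C * (x1 +i* x2) + y%:C * (y1 +i* y2))) <= e.
Proof.
move=> h1 h2; apply: le_trans (normc_ReIm _) _; rewrite (splitr e).
case: z w h1 h2 => a b [c d] /= h1 h2; apply: lerD.
  by apply: le_trans h1; rewrite le_eqVlt; apply/orP; left; apply/eqP; congr `|_|; ring.
by apply: le_trans h2; rewrite le_eqVlt; apply/orP; left; apply/eqP; congr `|_|; ring.
Qed.

(** X and Y stand for the partial derivatives of a function: on the left are its derivatives
    in the real directions z and i z.  Their combination with coefficient [unit_i b]
    cancels the multiple of the conjugate of z, or of z. *)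
Lemma wirtinger_identity (b : bool) z h X Y :
  h * ((complex.Re (1 * z))%:C * X + (complex.Im (1 * z))%:C * Y) +
  unit_i b * (h * ((complex.Re ('i%C * z))%:C * X + (complex.Im ('i%C * z))%:C * Y)) =
  (if b then z else z^*) * h * (X + unit_i b * Y).
Proof.
have ii : 'i%C * 'i%C = -1 :> R[i] by rewrite -expr2 sqr_i.
have Ez : z = (complex.Re z)%:C + 'i%C * (complex.Im z)%:C by exact: complexE.
have Ec : z^* = (complex.Re z)%:C - 'i%C * (complex.Im z)%:C.
  by case: z {Ez} => x y; apply/eqP; rewrite eq_complex /=; apply/andP; split; apply/eqP; ring.
have e1 : complex.Re ('i%C * z) = - complex.Im z by rewrite mulrC ReiNIm.
have e2 : complex.Im ('i%C * z) = complex.Re z by rewrite mulrC ImiRe.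
rewrite mul1r e1 e2 rmorphN /=.
case: b.
  rewrite (_ : unit_i true = - 'i%C)//.
  rewrite [X in _ = X * h * _](_ : _ = (complex.Re z)%:C + 'i%C * (complex.Im z)%:C);
    last exact: Ez.
  transitivity (h * ((complex.Re z)%:C * X - 'i%C * 'i%C * (- (complex.Im z)%:C * - Y)
     - 'i%C * (- (complex.Im z)%:C * X + (complex.Re z)%:C * Y))); last by ring.
  by rewrite ii; ring.
rewrite (_ : unit_i false = 'i%C)//.
rewrite [X in _ = X * h * _](_ : _ = (complex.Re z)%:C - 'i%C * (complex.Im z)%:C);
  last exact: Ec.
transitivity (h * ((complex.Re z)%:C * X - 'i%C * 'i%C * ((complex.Im z)%:C * Y)
     + 'i%C * (- (complex.Im z)%:C * X + (complex.Re z)%:C * Y))); last by ring.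
by rewrite ii; ring.
Qed.

End wirtinger_identities.

Section bounded_continuous.
Context {R : realType}.
Implicit Types (p q w : R * R) (Phi Psi : R * R -> R[i]).

Definition bcont (Phi : R * R -> R[i]) := [/\ continuous (fun p => complex.Re (Phi p)),
  continuous (fun p => complex.Im (Phi p)) & exists G : R, forall p, normc (Phi p) <= G].

Lemma bcontD Phi Psi : bcont Phi -> bcont Psi -> bcont (fun p => Phi p + Psi p).
Proof.
move=> [c1 c2 [G hG]] [d1 d2 [H hH]]; split.
- rewrite (_ : (fun p => _) = fun p => complex.Re (Phi p) + complex.Re (Psi p)).
    by move=> p; apply: cvgD; [exact: c1 | exact: d1].
  by apply/funext => p; case: (Phi p) (Psi p) => ? ? [].
- rewrite (_ : (fun p => _) = fun p => complex.Im (Phi p) + complex.Im (Psi p)).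
    by move=> p; apply: cvgD; [exact: c2 | exact: d2].
  by apply/funext => p; case: (Phi p) (Psi p) => ? ? [].
- by exists (G + H) => p; apply: le_trans (le_normcD _ _) _; exact: lerD.
Qed.

Lemma bcontZ (c : R[i]) Phi : bcont Phi -> bcont (fun p => c * Phi p).
Proof.
case: c => a b [c1 c2 [G hG]]; split.
- rewrite (_ : (fun p => _) = fun p => a * complex.Re (Phi p) - b * complex.Im (Phi p)).
    by move=> p; apply: cvgB; apply: cvgM; [exact: cvg_cst|exact: c1|exact: cvg_cst|exact: c2].
  by apply/funext => p; case: (Phi p).
- rewrite (_ : (fun p => _) = fun p => a * complex.Im (Phi p) + b * complex.Re (Phi p)).
    by move=> p; apply: cvgD; apply: cvgM; [exact: cvg_cst|exact: c2|exact: cvg_cst|exact: c1].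
  by apply/funext => p; case: (Phi p).
- exists (normc (a +i* b) * G) => p; rewrite normcM ler_wpM2l//; exact: normc_ge0.
Qed.

Lemma bcont_translate Phi w : bcont Phi -> bcont (fun p => Phi (p - w)).
Proof.
move=> [c1 c2 [G hG]].
have sh : continuous (fun q : R * R => q - w).
  by move=> q; apply: cvgB; [exact: cvg_id|exact: cvg_cst].
split; last by exists G.
  by move=> p; exact: (continuous_comp (sh p) (c1 (p - w))).
by move=> p; exact: (continuous_comp (sh p) (c2 (p - w))).
Qed.

Variables (K : set (R * R)) (cK : compact K).

Lemma smooth_in_Re_continuous phi : smooth_in K phi ->
  continuous (fun p => complex.Re (phi p)).
Proof. by move=> [s _]; have [] := s 0%N. Qed.

Lemma smooth_in_Im_continuous phi : smooth_in K phi ->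
  continuous (fun p => complex.Im (phi p)).
Proof. by move=> [s _]; have [] := s 0%N. Qed.

Lemma smooth_in_bcont phi : smooth_in K phi -> bcont phi.
Proof.
move=> s; have [_ z] := s.
have c1 := smooth_in_Re_continuous s; have c2 := smooth_in_Im_continuous s.
split => //.
have [G hG] : exists G : R, forall p, `|complex.Re (phi p)| <= G.
  by apply: (compact_support_bounded cK) => // p /z ->.
have [G' hG'] : exists G : R, forall p, `|complex.Im (phi p)| <= G.
  by apply: (compact_support_bounded cK) => // p /z ->.
by exists (G + G') => p; apply: le_trans (normc_ReIm _) _; exact: lerD.
Qed.

Lemma smooth_in_Re_uniform_continuous phi : smooth_in K phi -> forall e, 0 < e ->
  exists2 eta : R, 0 < eta & forall p q, ball p eta q ->
    `|complex.Re (phi p) - complex.Re (phi q)| < e.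
Proof.
move=> s; have [_ z] := s; apply: (compact_support_uniform_continuous cK).
  exact: smooth_in_Re_continuous.
by move=> p /z ->.
Qed.

Lemma smooth_in_Im_uniform_continuous phi : smooth_in K phi -> forall e, 0 < e ->
  exists2 eta : R, 0 < eta & forall p q, ball p eta q ->
    `|complex.Im (phi p) - complex.Im (phi q)| < e.
Proof.
move=> s; have [_ z] := s; apply: (compact_support_uniform_continuous cK).
  exact: smooth_in_Im_continuous.
by move=> p /z ->.
Qed.

Lemma smooth_in_uniform_continuous phi : smooth_in K phi -> forall e, 0 < e ->
  exists2 eta : R, 0 < eta & forall p q, ball p eta q -> normc (phi p - phi q) <= e.
Proof.
move=> s e e0; have e20 : 0 < e / 2 by rewrite divr_gt0.
have [e1 e10 h1] := smooth_in_Re_uniform_continuous s e20.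
have [e2 e20' h2] := smooth_in_Im_uniform_continuous s e20.
exists (Num.min e1 e2); first by rewrite lt_min e10.
move=> p q pq; apply: le_trans (normc_ReIm _) _; rewrite (splitr e).
have l1 : Num.min e1 e2 <= e1 by rewrite ge_min lexx.
have l2 : Num.min e1 e2 <= e2 by rewrite ge_min lexx orbT.
have k1 := ltW (h1 p q (le_ball l1 pq)); have k2 := ltW (h2 p q (le_ball l2 pq)).
by apply: lerD; [move: k1|move: k2]; case: (phi p) (phi q) => ? ? [].
Qed.

End bounded_continuous.

(** * Networks and their uniform limits on the ball *)

Section networks.
Context {R : realType} (n : nat) (r : R) (U : set R[i]) (rho : R[i] -> R[i]).
Implicit Types (z a : 'rV[R[i]]_n) (F G : 'rV[R[i]]_n -> R[i]).

(** A unit is a triple (c, (a, b)) of an outer weight, an inner weight and a bias. *)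
Definition network (s : seq (R[i] * ('rV[R[i]]_n * R[i]))) z : R[i] :=
  \sum_(x <- s) x.1 * rho (cdot x.2.1 z + x.2.2).

Definition admissible (s : seq (R[i] * ('rV[R[i]]_n * R[i]))) : Prop :=
  forall x z, x \in s -> ecball r z -> U (cdot x.2.1 z + x.2.2).

Definition approximable F := forall e : R, 0 < e -> exists s, admissible s /\
  forall z, ecball r z -> normc (network s z - F z) <= e.

Lemma eq_approximable F G : (forall z, ecball r z -> F z = G z) ->
  approximable F -> approximable G.
Proof.
move=> FG aF e e0; have [s [ss sF]] := aF e e0.
by exists s; split => // z Bz; rewrite -FG//; exact: sF.
Qed.

Lemma approximable_lim F :
  (forall e : R, 0 < e -> exists2 G, approximable G &
     forall z, ecball r z -> normc (G z - F z) <= e) -> approximable F.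
Proof.
move=> h e e0; have e20 : 0 < e / 2 by rewrite divr_gt0.
have [G aG GF] := h _ e20; have [s [ss sG]] := aG _ e20.
exists s; split => // z Bz.
have -> : network s z - F z = (network s z - G z) + (G z - F z) by ring.
by apply: le_trans (le_normcD _ _) _; rewrite (splitr e) lerD ?sG ?GF.
Qed.

Lemma approximableD F G : approximable F -> approximable G ->
  approximable (fun z => F z + G z).
Proof.
move=> aF aG e e0; have e20 : 0 < e / 2 by rewrite divr_gt0.
have [s [ss sF]] := aF _ e20; have [t [tt tG]] := aG _ e20.
exists (s ++ t); split.
  by move=> x z; rewrite mem_cat => /orP[xs|xt]; [exact: ss | exact: tt].
move=> z Bz; rewrite /network big_cat /=.
have -> : \sum_(x <- s) x.1 * rho (cdot x.2.1 z + x.2.2) +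
    \sum_(x <- t) x.1 * rho (cdot x.2.1 z + x.2.2) - (F z + G z) =
    (network s z - F z) + (network t z - G z) by rewrite /network; ring.
by apply: le_trans (le_normcD _ _) _; rewrite (splitr e) lerD ?sF ?tG.
Qed.

Lemma approximableZ (c : R[i]) F : approximable F -> approximable (fun z => c * F z).
Proof.
move=> aF e e0; have c0 : 0 < normc c + 1 by rewrite ltr_wpDl ?normc_ge0.
have [s [ss sF]] := aF _ (divr_gt0 e0 c0).
exists [seq (c * x.1, x.2) | x <- s]; split.
  by move=> x z /mapP[y ys ->] /=; exact: (ss y z ys).
move=> z Bz; rewrite /network big_map /=.
have -> : \sum_(x <- s) c * x.1 * rho (cdot x.2.1 z + x.2.2) - c * F z =
    c * (network s z - F z).
  by rewrite mulrBr /network mulr_sumr; congr (_ - _); apply: eq_bigr => x _; rewrite mulrA.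
rewrite normcM; apply: le_trans (ler_wpM2l (normc_ge0 _) (sF z Bz)) _.
by rewrite mulrCA ler_piMr ?(ltW e0)// ler_pdivrMr// mul1r lerDl.
Qed.

(** This norm controls a . z on the ball, and it grows by at most the modulus of c when c
    is added to one coordinate of a. *)
Definition l1norm a : R := \sum_(i < n) normc (a 0 i).

Lemma l1norm_ge0 a : 0 <= l1norm a.
Proof. by apply: sumr_ge0 => k _; exact: normc_ge0. Qed.

Lemma normc_coord z i : ecball r z -> normc (z 0 i) <= r.
Proof.
apply: le_trans; rewrite -[leLHS]ger0_norm ?normc_ge0// -sqrtr_sqr ler_wsqrtr//.
by rewrite (bigD1 i)//= lerDl sumr_ge0// => k _; exact: sqr_ge0.
Qed.

Lemma normc_cdot a z : ecball r z -> normc (cdot a z) <= l1norm a * r.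
Proof.
move=> Bz; apply: le_trans (normc_sum _ _) _; rewrite /l1norm mulr_suml.
by apply: ler_sum => k _; rewrite normcM ler_wpM2l ?normc_ge0// normc_coord.
Qed.

Lemma cdot_add_delta a z i (c : R[i]) :
  cdot (a + c *: delta_mx 0 i) z = cdot a z + c * z 0 i.
Proof.
rewrite /cdot; under eq_bigr do rewrite !mxE mulrDl.
rewrite big_split /=; congr (_ + _); rewrite (bigD1 i)//= ?eqxx mulr1.
by rewrite big1 ?addr0// => k ki; rewrite (negbTE ki) ?andbF mulr0 mul0r.
Qed.

Lemma l1norm_add_delta a i (c : R[i]) :
  l1norm (a + c *: delta_mx 0 i) <= l1norm a + normc c.
Proof.
rewrite /l1norm (bigD1 i)//= [in leRHS](bigD1 i)//= addrAC lerD//.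
  by rewrite !mxE !eqxx mulr1; exact: le_normcD.
apply: ler_sum => k ki; rewrite !mxE (negbTE ki) ?andbF mulr0 addr0//.
Qed.

End networks.

(** * Averages of rho are uniform limits of networks *)

Section averages.
Context {R : realType}.
Implicit Types (p q w : R * R).
Local Notation mu := (lebesgue2 R).
(** The bounded open set E lies in the domain U of rho, with rho bounded by M on it, and the
    null set N contains the points of E where rho is discontinuous.  Thus rho is
    continuous, hence Borel measurable, on the complement D of N in E. *)
Variables (U : set R[i]) (rho : R[i] -> R[i]) (E N : set (R * R)) (A M : R).
Hypotheses (oE : open E) (EA : E `<=` ball 0 A) (EU : E `<=` @toC R @^-1` U).
Hypothesis rhoM : forall p, E p -> normc (rho (toC p)) <= M.
Hypotheses (mN : measurable N) (N0 : mu N = 0%E).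
Hypothesis rhoC : forall p, E p -> ~ N p -> {for toC p, continuous rho}.
Let D := E `\` N.

Let mE : measurable E. Proof. exact: open_plane_measurable. Qed.
Let mD : measurable D. Proof. exact: measurableD. Qed.
Let fD : (mu D < +oo)%E.
Proof. by apply: bounded_plane_measure mD _; apply: subset_trans EA; exact: subDsetl. Qed.

Let cint_sum' := @cint_sum _ _ R mu D mD fD.
Let cintZ' := @cintZ _ _ R mu D mD fD.
Let cintD' := @cintD _ _ R mu D mD fD.
Let normc_cint' := @normc_cint _ _ R mu D mD fD.
Let bmeas_integrable' := @bmeas_integrable _ _ R mu D mD fD.

Lemma rho_cbmeas : cbmeas D (rho \o @toC R).
Proof.
have crho p : D p -> {for p, continuous (rho \o @toC R)}.
  by move=> [Ep Np]; apply: continuous_comp; [exact: toC_continuous | exact: rhoC].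
split; split.
- apply: measurable_fun_continuous_at => // p /crho cp.
  by apply: continuous_comp cp _; exact: Re_continuous.
- by exists M => p [Ep _]; exact: le_trans (normc_Re _) (rhoM Ep).
- apply: measurable_fun_continuous_at => // p /crho cp.
  by apply: continuous_comp cp _; exact: Im_continuous.
- by exists M => p [Ep _]; exact: le_trans (normc_Im _) (rhoM Ep).
Qed.

Lemma bcont_cbmeas Phi : bcont Phi -> cbmeas D Phi.
Proof.
move=> [c1 c2 [G hG]]; split; split.
- by apply: measurable_fun_continuous_at => // p _; exact: c1.
- by exists G => p _; exact: le_trans (normc_Re _) (hG p).
- by apply: measurable_fun_continuous_at => // p _; exact: c2.
- by exists G => p _; exact: le_trans (normc_Im _) (hG p).
Qed.

(** Neither the null set N nor the part of U where Phi vanishes contributes. *)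
Lemma dist_ofE Phi : (forall p, ~ E p -> Phi p = 0) ->
  dist_of U rho Phi = cint mu D (fun p => rho (toC p) * Phi p).
Proof.
move=> Phi0; rewrite /dist_of /cint.
suff h (f : R[i] -> R) : f 0 = 0 -> \int[mu]_(p in @toC R @^-1` U) f (rho (toC p) * Phi p) =
    \int[mu]_(x in D) f (rho (toC x) * Phi x).
  by congr (_ +i* _); apply: h.
move=> f0; rewrite /Rintegral /D -integral_setD_null//; congr fine.
rewrite integral_mkcond [RHS]integral_mkcond; apply: eq_integral => p _.
rewrite !patchE; case: ifPn => pU; case: ifPn => pE //.
  by move: pE; rewrite notin_setE => /Phi0 ->; rewrite mulr0 f0.
by move: pU; rewrite notin_setE => h; exfalso; exact/h/EU/set_mem.
Qed.

(** The points around which rho varies by more than delta at scale h form an open set,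
    which decreases with h.  By continuity of rho on D, no point of D is in all these
    sets, so that the measure of their trace on D tends to 0. *)
Lemma small_oscillation (delta kappa h0 : R) : 0 < delta -> 0 < kappa -> 0 < h0 ->
  exists h (O : set (R * R)), [/\ 0 < h < h0, measurable O,
    fine (mu (O `&` D)) <= kappa &
    forall p q, E p -> E q -> ball p h q -> ~ O p ->
      normc (rho (toC q) - rho (toC p)) <= delta].
Proof.
move=> d0 k0 h00.
pose r m : R := Num.min (h0 / 2) m.+1%:R^-1.
have r0 m : 0 < r m by rewrite lt_min divr_gt0//= invr_gt0.
pose O m := [set p | exists s t, [/\ ball s (r m) p, ball t (r m) p, E s, E t &
   delta < normc (rho (toC s) - rho (toC t))]].
have oO m : open (O m).
  rewrite openE => p [s [t [sp tp Es Et st]]].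
  have h1 : nbhs p (ball s (r m)).
    by apply: open_nbhs_nbhs; split => //; exact: ball_open.
  have h2 : nbhs p (ball t (r m)).
    by apply: open_nbhs_nbhs; split => //; exact: ball_open.
  by apply: filterS2 h1 h2 => q sq tq; exists s, t.
have mO m : measurable (O m) by exact: open_plane_measurable.
have mOD m : measurable (O m `&` D) by exact: measurableI.
have fOD m : (mu (O m `&` D) < +oo)%E.
  apply: le_lt_trans fD; apply: le_measure;
    [rewrite inE; exact: mOD | rewrite inE; exact: mD | exact: subIsetr].
have cap0 : \bigcap_m (O m `&` D) = set0.
  apply/seteqP; split => // p hp.
  have [_ [Ep Np]] := hp 0%N I.
  have /(toC_continuous (x := p)) :
      nbhs (toC p) (rho @^-1` [set z | normc (rho (toC p) - z) < delta / 2]).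
    apply: (rhoC Ep Np); apply/nbhs_complexP; exists (delta / 2) => //.
    by rewrite divr_gt0.
  move=> /nbhs_ballP[e /= e0 he].
  have [m _ hm] : \forall m \near \oo, m.+1%:R^-1 < e :> R.
    exact: near_infty_natSinv_lt (PosNum e0).
  have me : r m <= e.
    by apply: le_trans (ltW (hm m (leqnn m))); rewrite ge_min lexx orbT.
  have [[s [t [sp tp Es Et st]]] _] := hp m I.
  move: st; rewrite ltNge => /negP; apply.
  have hs := he s (ball_sym (le_ball me sp)).
  have ht := he t (ball_sym (le_ball me tp)).
  rewrite [X in normc X](_ : _ = (rho (toC p) - rho (toC t)) -
    (rho (toC p) - rho (toC s))); last by ring.
  apply: le_trans (le_normcD _ _) _; rewrite normcN (splitr delta) addrC.
  by apply: lerD; apply: ltW; [exact: hs | exact: ht].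
have cv : (mu \o (fun m => O m `&` D)) @ \oo --> mu (\bigcap_m (O m `&` D)).
  apply: nonincreasing_cvg_mu.
  - exact: fOD.
  - exact: mOD.
  - by rewrite cap0.
  - move=> m n mn; apply/subsetPset => p [[s [t [sp tp Es Et st]]] Dp]; split=> //.
    have rmn : r n <= r m.
      by rewrite /r le_min !ge_min lexx /= lef_pV2 ?posrE ?ltr0n// ler_nat ltnS mn orbT.
    by exists s, t; split => //; [exact: le_ball sp | exact: le_ball tp].
rewrite cap0 measure0 in cv.
have fin m : mu (O m `&` D) \is a fin_num.
  by rewrite ge0_fin_numE//; exact: fOD.
have [m _ hm] : \forall m \near \oo, (mu (O m `&` D) < kappa%:E)%E.
  have hk : nbhs (0%E : \bar R) (fun u : \bar R => (u < kappa%:E)%E).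
    by apply: open_ereal_lt'; rewrite lte_fin.
  exact: (cv _ hk).
exists (r m), (O m); split => //.
- by rewrite r0 /= gt_min ltr_pdivrMr// ltr_pMr// ltr1n.
- by rewrite -lee_fin fineK//; exact: ltW (hm m (leqnn m)).
- move=> p q Ep Eq pq; apply: contra_notP => /negP; rewrite -ltNge => h.
  exists q, p; split => //; first exact: ball_sym.
  exact: ballxx.
Qed.

(** The squares of the grid are translated by w together with phi: the sample points
    become t + w, while the weights h^2 phi(t) are independent of w.  On a square, the
    error comes from the modulus of continuity of phi and from the oscillation of rho,
    which is small outside a set of small measure ([small_oscillation]); neither depends
    on w. *)
Lemma uniform_riemann_sums (phi : R * R -> R[i]) (d d' : R) : 0 <= d' -> d' < d ->
  bcont phi ->
  (forall e, 0 < e -> exists2 eta : R, 0 < eta &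
     forall p q, ball p eta q -> normc (phi p - phi q) <= e) ->
  (forall p, phi p != 0 -> ball p d `<=` E) ->
  forall eps, 0 < eps -> exists s : seq (R[i] * (R * R)),
    (forall x, x \in s -> phi x.2 != 0) /\
    forall w, `|w.1| <= d' -> `|w.2| <= d' ->
      normc (cint mu D (fun p => rho (toC p) * phi (p - w)) -
             \sum_(x <- s) x.1 * rho (toC (x.2 + w))) <= eps.
Proof.
move=> d'0 dd' bphi phiU phiE eps eps0; have [_ _ [G phiG]] := bphi.
have G0 : 0 <= G by apply: le_trans (phiG 0); exact: normc_ge0.
pose M' := `|M|; have M'0 : 0 <= M' by exact: normr_ge0.
have rhoM' p : E p -> normc (rho (toC p)) <= M'.
  by move=> Ep; apply: le_trans (rhoM Ep) _; exact: ler_norm.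
pose V := fine (mu D); have V0 : 0 <= V by apply: fine_ge0; exact: measure_ge0.
(* With om bounding the variations of phi and rho, and ka the measure of the exceptional
   set, the total error is at most 2 * ((M' + G) * om * V + 2 * G * M' * ka). *)
pose om := eps / (4 * (M' + G + 1) * (V + 1)).
have om0 : 0 < om by rewrite divr_gt0// mulr_gt0 ?mulr_gt0//; lra.
pose ka := eps / (8 * (G * M' + 1)).
have GM0 : 0 <= G * M' by rewrite mulr_ge0.
have ka0 : 0 < ka by rewrite divr_gt0// mulr_gt0//; lra.
have [eta eta0 heta] := phiU om om0.
have [h [Z [hh mZ muZ osc]]] : exists h (Z : set (R * R)),
   [/\ 0 < h < Num.min eta (d - d'), measurable Z,
    fine (mu (Z `&` D)) <= ka &
    forall p q, E p -> E q -> ball p h q -> ~ Z p ->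
      normc (rho (toC q) - rho (toC p)) <= om].
  by apply: small_oscillation => //; rewrite lt_min eta0 subr_gt0.
move: hh; rewrite lt_min => /andP[h0 /andP[heta1 hd]].
pose n := Num.bound (2 * `|A| / h).
have nh : 2 * `|A| < n%:R * h.
  rewrite -ltr_pdivrMr//; apply: le_lt_trans (archi_boundP _); first exact: lexx.
  by rewrite divr_ge0 ?(ltW h0)// mulr_ge0.
pose t (i : 'I_n * 'I_n) := corner (- `|A|) h i.
pose c w i := rho (toC (t i + w)) * phi (t i).
exists [seq ((h * h)%:C * phi (t i), t i)
       | i <- index_enum ('I_n * 'I_n)%type & phi (t i) != 0].
split.
  by move=> x /mapP[k]; rewrite mem_filter => /andP[tk _] ->.
move=> w w1 w2.
(* The margin d - d' leaves room for the cell once it has been translated by w. *)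
have wE i : phi (t i) != 0 -> cell h (t i + w) `<=` E.
  move=> /phiE tE p /ball_of_cell tp; apply/tE/(ball_translate_le tp w1 w2).
  by rewrite -ltrBrDr.
have tcell i : cell h (t i + w) (t i + w).
  by split; rewrite /= in_itv/= lexx ltrDl.
have bF : cbmeas D (fun p => rho (toC p) * phi (p - w)).
  by apply: cbmeasM; [exact: rho_cbmeas | exact/bcont_cbmeas/bcont_translate].
pose S p := \sum_(i : 'I_n * 'I_n) c w i * (\1_(cell h (t i + w)) p : R)%:C.
have bSi i : cbmeas D (fun p => c w i * (\1_(cell h (t i + w)) p : R)%:C).
  by apply: cbmeasZ; apply: cbmeas_indic; exact: measurable_cell.
have bS : cbmeas D S by apply: cbmeas_sum.
have intS : cint mu D S = \sum_(i : 'I_n * 'I_n) c w i * (h * h)%:C.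
  rewrite cint_sum'//; apply: eq_bigr => i _.
  rewrite cintZ'; last by apply: cbmeas_indic; exact: measurable_cell.
  rewrite cint_indic//; last exact: measurable_cell.
  have [z|nz] := eqVneq (phi (t i)) 0; first by rewrite /c z mulr0 !mul0r.
  congr (_ * _%:C); rewrite /D -integral_indic//; last exact: measurable_cell.
  rewrite -integral_setD_null// integral_indic//; last exact: measurable_cell.
  rewrite setIidl; last exact: wE.
  exact: (congr1 fine (square_measure (t i + w).1 (t i + w).2 (ltW h0))).
have -> : \sum_(x <- [seq ((h * h)%:C * phi (t i), t i)
                      | i <- index_enum ('I_n * 'I_n)%type & phi (t i) != 0])
    x.1 * rho (toC (x.2 + w)) = cint mu D S.
  rewrite intS big_map big_filter big_mkcond /=; apply: eq_bigr => k _.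
  by rewrite /c; have [->|_] /= := eqVneq; [rewrite mulr0 mul0r | ring].
(* The last term is for the exceptional set, where rho varies by at most 2 * M'. *)
pose b p := (M' + G) * om + 2 * G * M' * (\1_Z p : R).
have bb : bmeas D b.
  apply: bmeasD; first exact: bmeas_cst.
  by apply: bmeasZ; exact: bmeas_indic.
have ind0 p : 0 <= \1_Z p :> R by rewrite indicE.
have om0' := ltW om0.
have b20 p : 0 <= G * om + 2 * G * M' * \1_Z p :> R.
  apply: addr_ge0; first exact: mulr_ge0.
  by apply: mulr_ge0 => //; apply: mulr_ge0 => //; exact: mulr_ge0.
have Fb i p : D p -> cell h (t i + w) p ->
    normc (rho (toC p) * phi (p - w) - c w i) <= b p.
  move=> [Ep Np] cp.
  have tp := ball_of_cell cp.
  have h1 : normc (phi (p - w) - phi (t i)) <= om.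
    by rewrite normcB; apply: heta; apply: le_ball tp; exact: ltW.
  have h2 : normc (rho (toC p) * (phi (p - w) - phi (t i))) <= M' * om.
    by rewrite normcM ler_pM ?normc_ge0 ?rhoM'.
  have -> : rho (toC p) * phi (p - w) - c w i = rho (toC p) * (phi (p - w) - phi (t i)) +
     (rho (toC p) - rho (toC (t i + w))) * phi (t i) by rewrite /c; ring.
  apply: le_trans (le_normcD _ _) _; rewrite /b [(M' + G) * om]mulrDl -addrA lerD// normcM mulrC.
  have [->|nz] := eqVneq (phi (t i)) 0.
    by rewrite normc0 mul0r.
  have Et : E (t i + w) by exact: (wE i nz _ (tcell i)).
  rewrite indicE; case: (boolP (p \in Z)) => [_|]; last first.
    rewrite notin_setE => nZ; rewrite mulr0 addr0 ler_pM ?normc_ge0//.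
    rewrite normcB; apply: osc => //.
    exact/ball_sym/ball_untranslate.
  rewrite mulr1; apply: (@le_trans _ _ (G * (2 * M'))).
    rewrite ler_pM ?normc_ge0//; apply: le_trans (le_normcD _ _) _.
    by rewrite normcN mulr_natl mulr2n lerD// rhoM'.
  by rewrite [leLHS](_ : _ = 2 * G * M'); [rewrite lerDr mulr_ge0// ltW|ring].
have FS p : D p -> normc (rho (toC p) * phi (p - w) - S p) <= b p.
  move=> Dp.
  have b0 : 0 <= b p.
    by rewrite /b [(M' + G) * om]mulrDl -addrA addr_ge0// mulr_ge0.
  have E1 := sum_indic_cells (- `|A|) n p w (ltW h0).
  have big : phi (p - w) != 0 -> \sum_(i : 'I_n * 'I_n) \1_(cell h (t i + w)) p = 1 :> R.
    move=> nz; have /EA : E (p - w).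
      by apply: (phiE _ nz); apply: ballxx; exact: le_lt_trans d'0 dd'.
    by move=> /ball_planeP /=; rewrite E1 !sub0r !normrN => 
      -[/(itv_of_norm nh)-> /(itv_of_norm nh)->]; rewrite mulr1.
  have le1 : \sum_(i : 'I_n * 'I_n) \1_(cell h (t i + w)) p <= 1 :> R.
    by rewrite E1 -natrM mulnb lern1 leq_b1.
  have -> : rho (toC p) * phi (p - w) - S p = \sum_(i : 'I_n * 'I_n)
      (rho (toC p) * phi (p - w) - c w i) * (\1_(cell h (t i + w)) p : R)%:C.
    under [RHS]eq_bigr do rewrite mulrBl.
    rewrite big_split /= sumrN; congr (_ - _).
    rewrite -mulr_sumr -rmorph_sum /=.
    have [->|/big ->] := eqVneq (phi (p - w)) 0; first by rewrite mulr0 mul0r.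
    by rewrite mulr1.
  apply: le_trans (normc_sum _ _) _.
  apply: (@le_trans _ _ (\sum_(i : 'I_n * 'I_n) b p * \1_(cell h (t i + w)) p)).
    apply: ler_sum => k _; rewrite normcM normc_real indicE.
    case: (boolP (p \in _)) => /= [/set_mem kp|_]; last by rewrite normr0 !mulr0.
    by rewrite normr1 !mulr1; exact: Fb.
  by rewrite -mulr_sumr ler_piMr.
rewrite -[X in normc X](_ :
  cint mu D (fun p => rho (toC p) * phi (p - w) + (-1) * S p) = _); last first.
  by rewrite cintD'//; [rewrite cintZ'// mulN1r | exact: cbmeasZ].
apply: le_trans (normc_cint' _ bb _) _.
- by apply: cbmeasD => //; exact: cbmeasZ.
- by move=> p Dp; rewrite mulN1r; exact: FS.
have bZ : bmeas D (\1_Z : R * R -> R) by exact: bmeas_indic.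
rewrite RintegralD//; last 2 first.
- by apply: bmeas_integrable'; exact: bmeas_cst.
- by apply: bmeas_integrable'; exact: bmeasZ.
rewrite Rintegral_cst// RintegralZl//; last exact: bmeas_integrable'.
rewrite /Rintegral integral_indic// -/V.
have k1 : (M' + G) * om * V <= eps / 4.
  have -> : eps / 4 = (M' + G + 1) * om * (V + 1).
    by rewrite /om; field; apply/andP; split; apply: lt0r_neq0; lra.
  have MG0 : 0 <= M' + G by exact: addr_ge0.
  apply: ler_pM => //; [exact: mulr_ge0 | | by rewrite lerDl].
  by rewrite ler_wpM2r// lerDl.
have k2 : 2 * G * M' * fine (mu (Z `&` D)) <= eps / 4.
  apply: (@le_trans _ _ (2 * (G * M' + 1) * ka)).
    by rewrite ler_pM ?fine_ge0 ?measure_ge0 ?mulr_ge0// -mulrA ler_pM ?lerDl.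
  by rewrite [leLHS](_ : _ = eps / 4)// /ka; field; apply: lt0r_neq0; lra.
lra.
Qed.

(** * Monomials are uniform limits of networks *)

(** If l1norm a * r < d, then for z in the ball the translates by a . z of the functions
    supported in K vanish off E. *)
Variables (K : set (R * R)) (d : R).
Hypotheses (cK : compact K) (d0 : 0 < d) (Kd : forall p, K p -> ball p d `<=` E).
Variables (n : nat) (r : R).
Hypothesis r0 : 0 < r.

Let clK : closed K. Proof. apply: compact_closed => //; exact: norm_hausdorff. Qed.

Definition pairing (Phi : R * R -> R[i]) : R[i] :=
  cint mu D (fun p => rho (toC p) * Phi p).

Let bp Phi : bcont Phi -> cbmeas D (fun p => rho (toC p) * Phi p).
Proof. by move=> b; apply: cbmeasM; [exact: rho_cbmeas | exact: bcont_cbmeas]. Qed.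

Lemma pairingD Phi Psi : bcont Phi -> bcont Psi ->
  pairing (fun p => Phi p + Psi p) = pairing Phi + pairing Psi.
Proof.
move=> b1 b2; rewrite /pairing -cintD'//; try exact: bp.
by apply: eq_cint => p _; rewrite mulrDr.
Qed.

Lemma pairingZ c Phi : bcont Phi -> pairing (fun p => c * Phi p) = c * pairing Phi.
Proof.
move=> b1; rewrite /pairing -cintZ'//; try exact: bp.
by apply: eq_cint => p _; rewrite mulrCA.
Qed.

Lemma normc_pairing Phi e : bcont Phi -> (forall p, normc (Phi p) <= e) ->
  normc (pairing Phi) <= 2 * (`|M| * fine (mu D)) * e.
Proof.
move=> b1 h; rewrite /pairing.
have := normc_cint' (bp b1) (bmeas_cst D (`|M| * e)).
rewrite Rintegral_cst// => h'; apply: le_trans (h' _) _; last by rewrite -!mulrA (mulrC e) !mulrA.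
move=> p [Ep _]; rewrite normcM ler_pM ?normc_ge0//.
by apply: le_trans (rhoM Ep) _; exact: ler_norm.
Qed.

Local Notation approximable := (@approximable R n r U rho).

(** The statement proved by induction on the monomial h.  It concerns all small slopes a,
    and not only a = 0, so that it can be differentiated with respect to a. *)
Definition weighted (h : 'rV[R[i]]_n -> R[i]) (phi : R * R -> R[i]) : Prop :=
  [/\ smooth_in K phi,
      exists C : R, forall z, ecball r z -> normc (h z) <= C &
      forall a, l1norm a * r < d ->
        approximable (fun z => h z * pairing (fun p => phi (p - ofC (cdot a z))))].

(** Riemann sums of the average are networks all of whose units have inner weight a. *)
Lemma weighted_base phi : smooth_in K phi -> weighted (fun=> 1) phi.
Proof.
move=> s; split => //; first by exists 1 => z _; rewrite normc1.
move=> a ad e e0; have [_ phi0] := s.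
have a0 : 0 <= l1norm a * r by rewrite mulr_ge0 ?l1norm_ge0// ltW.
have inK p : phi p != 0 -> K p by apply: contra_neqP => /phi0.
have [t [tK tS]] := uniform_riemann_sums a0 ad (smooth_in_bcont cK s)
   (smooth_in_uniform_continuous cK s) (fun p h => Kd (inK p h)) e0.
have cw z : ecball r z -> `|(ofC (cdot a z)).1| <= l1norm a * r /\
                          `|(ofC (cdot a z)).2| <= l1norm a * r.
  move=> Bz; have h := normc_cdot a Bz.
  by split; [exact: le_trans (normc_Re _) h | exact: le_trans (normc_Im _) h].
have E1 z (x : R * R) : cdot a z + toC x = toC (x + ofC (cdot a z)).
  by rewrite -toCD toC_ofC addrC.
exists [seq (x.1, (a, toC x.2)) | x <- t]; split.
  move=> x z /mapP[y yt ->] Bz /=; rewrite E1.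
  apply/EU/(Kd (inK _ (tK _ yt)))/ball_planeP => /=.
  have [h1 h2] := cw z Bz.
  by split; rewrite opprD addrA subrr sub0r normrN (le_lt_trans _ ad).
move=> z Bz; rewrite /network big_map /= normcB mul1r.
by under eq_bigr do rewrite E1; have [h1 h2] := cw z Bz; exact: tS.
Qed.

Definition directional (phi : R * R -> R[i]) (v p : R * R) : R[i] :=
  v.1%:C * cpartial (dirx R) phi p + v.2%:C * cpartial (diry R) phi p.

Lemma smooth_in_difference_quotient phi : smooth_in K phi -> forall e, 0 < e ->
  exists2 s0 : R, 0 < s0 & forall s p v, 0 < s < s0 -> `|v.1| <= r -> `|v.2| <= r ->
    normc ((s^-1)%:C * (phi (p + s *: v) + - 1 * phi p) + -1 * directional phi v p) <= e.
Proof.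
move=> sphi e e0; have e20 : 0 < e / 2 by rewrite divr_gt0.
have [sm _] := sphi; have [C1 C2] := sm 1%N.
have sx := smooth_in_cpartial clK axis_x sphi.
have sy := smooth_in_cpartial clK axis_y sphi.
have [s1 s10 h1] := C1_uniform_difference_quotient C1
  (smooth_in_Re_uniform_continuous cK sx) (smooth_in_Re_uniform_continuous cK sy) r0 e20.
have [s2 s20 h2] := C1_uniform_difference_quotient C2
  (smooth_in_Im_uniform_continuous cK sx) (smooth_in_Im_uniform_continuous cK sy) r0 e20.
exists (Num.min s1 s2); first by rewrite lt_min s10.
move=> s p v /andP[s_gt0]; rewrite lt_min => /andP[l1 l2] v1 v2.
have k1 : 0 < s < s1 by rewrite s_gt0.
have k2 : 0 < s < s2 by rewrite s_gt0.
exact: normc_quotient_le (h1 s p v k1 v1 v2) (h2 s p v k2 v1 v2).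
Qed.

(** Adding - s e to the i-th coordinate of a translates phi by s times - e z_i: the difference
    quotients of the averages converge, uniformly in z, to the average of the derivative
    of phi in the real direction e z_i. *)
Lemma weighted_directional h phi i (e : R[i]) : normc e = 1 -> weighted h phi ->
  forall a, l1norm a * r < d ->
  approximable (fun z => h z * pairing (fun p =>
    directional phi (ofC (e * z 0 i)) (p - ofC (cdot a z)))).
Proof.
move=> e1 [sphi [C hC] happ] a ad; apply: approximable_lim => eps eps0.
have C0 : 0 <= `|C| by [].
pose V := `|M| * fine (mu D).
have V0 : 0 <= V by rewrite mulr_ge0// fine_ge0// measure_ge0.
pose K0 := (`|C| + 1) * (2 * V + 1).
have K00 : 0 < K0 by rewrite mulr_gt0; lra.
have [s0 s00 hs] := smooth_in_difference_quotient sphi (divr_gt0 eps0 K00).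
(* The modified slope has to satisfy the smallness condition too. *)
pose s := Num.min (s0 / 2) ((d - l1norm a * r) / (2 * r)).
have s_gt0 : 0 < s by rewrite lt_min !divr_gt0 ?mulr_gt0 ?subr_gt0.
have ss0 : s < s0 by rewrite gt_min ltr_pdivrMr// ltr_pMr// ltr1n.
have sd : (l1norm a + s) * r < d.
  rewrite mulrDl -ltrBrDl.
  apply: (@le_lt_trans _ _ ((d - l1norm a * r) / (2 * r) * r)).
    by rewrite ler_wpM2r ?(ltW r0)// ge_min lexx orbT.
  have dd : 0 < d - l1norm a * r by rewrite subr_gt0.
  rewrite [ltLHS](_ : _ = (d - l1norm a * r) / 2); last by field; exact: lt0r_neq0.
  lra.
pose c := - (s%:C * e).
have nc : normc c = s by rewrite /c normcN normcM e1 mulr1 normc_real gtr0_norm.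
pose a' := a + c *: delta_mx 0 i.
have a'd : l1norm a' * r < d.
  apply: le_lt_trans sd; rewrite ler_wpM2r ?(ltW r0)// -nc.
  exact: l1norm_add_delta.
pose w z := ofC (cdot a z).
pose G z := (s^-1)%:C * (h z * pairing (fun p => phi (p - ofC (cdot a' z)))) +
            (-1) * ((s^-1)%:C * (h z * pairing (fun p => phi (p - w z)))).
exists G.
  by apply: approximableD; do ?apply: approximableZ; exact: happ.
move=> z Bz; pose v := ofC (e * z 0 i).
have vn : normc (e * z 0 i) <= r by rewrite normcM e1 mul1r normc_coord.
have v1 : `|v.1| <= r by apply: le_trans (normc_Re _) vn.
have v2 : `|v.2| <= r by apply: le_trans (normc_Im _) vn.
have wE p : p - ofC (cdot a' z) = (p - w z) + s *: v.
  rewrite /w /v cdot_add_delta /c mulNr -mulrA.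
  case: (cdot a z) (e * z 0 i) p => ar ai [er ei] [x y].
  by apply: injective_projections; rewrite /= /GRing.scale /=; ring.
have bphi0 := smooth_in_bcont cK sphi.
have bP := bcont_translate (w z) bphi0.
have bP' := bcont_translate (ofC (cdot a' z)) bphi0.
have bx := bcont_translate (w z) (smooth_in_bcont cK (smooth_in_cpartial clK axis_x sphi)).
have by_ := bcont_translate (w z) (smooth_in_bcont cK (smooth_in_cpartial clK axis_y sphi)).
have bd : bcont (fun p => directional phi v (p - w z)).
  by apply: bcontD; exact: bcontZ.
pose Q p := (s^-1)%:C * (phi (p - ofC (cdot a' z)) + -1 * phi (p - w z)) +
            -1 * directional phi v (p - w z).
have bq : bcont (fun p => phi (p - ofC (cdot a' z)) + -1 * phi (p - w z)).
  by apply: bcontD => //; exact: bcontZ.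
have bQ : bcont Q by apply: bcontD; exact: bcontZ.
have -> : G z - h z * pairing (fun p => directional phi v (p - w z)) = h z * pairing Q.
  have alg (k u x y t : R[i]) : k * (u * x) + -1 * (k * (u * y)) - u * t =
    u * (k * (x + -1 * y) + -1 * t) by ring.
  rewrite (pairingD (bcontZ _ bq) (bcontZ _ bd)) (pairingZ _ bq).
  rewrite (pairingD bP' (bcontZ _ bP)) (pairingZ _ bP) (pairingZ _ bd).
  exact: alg.
rewrite normcM.
have Qe p : normc (Q p) <= eps / K0.
  by rewrite /Q wE; apply: hs => //; rewrite s_gt0.
have hz : normc (h z) <= `|C| by apply: le_trans (hC z Bz) _; exact: ler_norm.
apply: le_trans (ler_pM (normc_ge0 _) (normc_ge0 _) hz (normc_pairing bQ Qe)) _.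
rewrite -/V mulrA mulrCA ler_piMr ?(ltW eps0)// ler_pdivrMr// mul1r.
by apply: ler_pM => //; [exact: mulr_ge0 | rewrite lerDl | rewrite lerDl].
Qed.

(** The derivatives along z_i and i z_i, obtained for e = 1 and e = 'i, are combined by
    [wirtinger_identity]. *)
Lemma weighted_step b i h phi : weighted h phi ->
  weighted (fun z => (if b then z 0 i else (z 0 i)^*) * h z) (wirtinger b phi).
Proof.
move=> W; have [sphi [C hC] _] := W; split.
- exact: smooth_in_wirtinger.
- exists (r * C) => z Bz; rewrite normcM ler_pM ?normc_ge0 ?hC//.
  have := normc_coord i Bz; case: b => //; case: (z 0 i) => x y /=.
  by rewrite sqrrN.
- move=> a ad; have n1 : normc (1 : R[i]) = 1 by exact: normc1.
  have A1 := weighted_directional i n1 W ad.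
  have Ai := approximableZ (unit_i b) (weighted_directional i (@normc_i R) W ad).
  apply: eq_approximable (approximableD A1 Ai) => z Bz.
  have bx := bcont_translate (ofC (cdot a z))
    (smooth_in_bcont cK (smooth_in_cpartial clK axis_x sphi)).
  have by_ := bcont_translate (ofC (cdot a z))
    (smooth_in_bcont cK (smooth_in_cpartial clK axis_y sphi)).
  have dirE v := etrans (pairingD (bcontZ v.1%:C bx) (bcontZ v.2%:C by_))
    (congr2 +%R (pairingZ _ bx) (pairingZ _ by_)).
  have wirtE := etrans (pairingD bx (bcontZ (unit_i b) by_))
    (congr1 (+%R _) (pairingZ _ by_)).
  rewrite [pairing (fun p => wirtinger b phi _)]wirtE.
  rewrite [pairing (fun p => directional phi (ofC (1 * z 0 i)) _)]dirE.
  rewrite [pairing (fun p => directional phi (ofC ('i%C * z 0 i)) _)]dirE.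
  exact: wirtinger_identity.
Qed.

Lemma dist_of_pairing phi : smooth_in K phi -> dist_of U rho phi = pairing phi.
Proof.
move=> [_ z]; rewrite dist_ofE// => p nEp; apply: z => Kp; apply: nEp.
by apply: (Kd Kp); exact: ballxx.
Qed.

Lemma dist_laplacianE (T : cdistribution R) phi : dist_laplacian T phi =
  T (cpartial (dirx R) (cpartial (dirx R) phi)) +
  T (cpartial (diry R) (cpartial (diry R) phi)).
Proof. exact: (congr2 +%R (opprK _) (opprK _)). Qed.

(** The two signs in a second distributional derivative cancel.  The outermost Laplacian
    of the distribution is the first one to act on phi, so its two terms have to be
    carried through the remaining ones by additivity. *)
Lemma iter_dist_laplacian m phi : smooth_in K phi ->
  iter m (@dist_laplacian R) (dist_of U rho) phi = pairing (iter m laplacian phi).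
Proof.
elim: m phi => [|m IH] phi s; first exact: dist_of_pairing.
have sxx := smooth_in_cpartial clK axis_x (smooth_in_cpartial clK axis_x s).
have syy := smooth_in_cpartial clK axis_y (smooth_in_cpartial clK axis_y s).
have b1 := smooth_in_bcont cK (smooth_in_iter_laplacian m clK sxx).
have b2 := smooth_in_bcont cK (smooth_in_iter_laplacian m clK syy).
have [cx _] := sxx; have [cy _] := syy.
rewrite [iter m.+1 laplacian phi]iterSr; apply: etrans (dist_laplacianE _ _) _.
apply: etrans (congr2 +%R (IH _ sxx) (IH _ syy)) _.
apply: etrans (esym (pairingD b1 b2)) _.
by apply: (congr1 pairing); exact: (esym (iter_laplacianD m cx cy)).
Qed.

(** The pair (b, i) stands for the factor z_i if b holds, for its conjugate otherwise. *)
Definition monomial (l : seq (bool * 'I_n)) (z : 'rV[R[i]]_n) : R[i] :=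
  foldr (fun x t => (if x.1 then z 0 x.2 else (z 0 x.2)^*) * t) 1 l.

Lemma weighted_monomial l phi : smooth_in K phi ->
  weighted (monomial l) (wirtinger_word (map fst l) phi).
Proof.
move=> s; elim: l => [|[b j] l IH]; first exact: weighted_base.
exact: (weighted_step b j IH).
Qed.

(** At a = 0 the average no longer depends on z: it is a nonzero constant, and the limit of
    networks can be divided by it. *)
Lemma approximable_monomial_of_laplacian l phi : smooth_in K phi ->
  iter (size l) (@dist_laplacian R) (dist_of U rho) phi != 0 ->
  approximable (monomial l).
Proof.
move=> s; rewrite iter_dist_laplacian//.
have [psi spsi E1] := iter_laplacian_wirtinger_word (map fst l) clK s.
rewrite size_map in E1; rewrite -E1 => nz.
have [_ _ W] := weighted_monomial l spsi.
have a0 : l1norm (0 : 'rV[R[i]]_n) * r < d.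
  by rewrite /l1norm big1 ?mul0r// => k _; rewrite mxE normc0.
apply: eq_approximable (approximableZ (pairing (wirtinger_word (map fst l) psi))^-1 (W 0 a0)).
move=> z Bz; rewrite (_ : (fun p => _) = wirtinger_word (map fst l) psi).
  by rewrite mulrC mulfK.
apply/funext => p; congr wirtinger_word; rewrite (_ : cdot 0 z = 0) ?subr0//.
by rewrite /cdot big1// => k _; rewrite mxE mul0r.
Qed.

End averages.

Section approximable_monomials.
Context {R : realType}.

(** Compactness makes local bounds around the points of K uniform. *)
Lemma compact_margin (U : set R[i]) (rho : R[i] -> R[i]) (K : set (R * R)) :
  open U -> [locally [bounded rho w | w in U]] ->
  compact K -> K `<=` @toC R @^-1` U ->
  exists d M : R, 0 < d /\ forall p q, K p -> ball p d q ->
    [/\ U (toC q), normc (rho (toC q)) <= M & ball 0 M q].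
Proof.
move=> oU hb cK KU.
pose P (x : R * R) p := forall q, ball p x.1 q ->
  [/\ U (toC q), normc (rho (toC q)) <= x.2 & ball 0 x.2 q].
have : \forall x \near filter_prod ((0 : R)^'+) (+oo_R), K `<=` P x.
  move/compact_near_coveringP : cK; apply => p Kp.
  have [e [M [e0 he]]] := locally_boundedP oU hb (KU p Kp).
  have e40 : 0 < e / 4 by rewrite divr_gt0.
  exists (ball p (e / 4), [set x | x.1 < e / 4 /\ Num.max M (`|p.1| + `|p.2| + e) < x.2]).
    split; first exact: nbhsx_ballx.
    exists ([set x | x < e / 4], [set x | Num.max M (`|p.1| + `|p.2| + e) < x]).
      split; first exact: nbhs_right_lt.
      by apply: nbhs_pinfty_gt; exact: num_real.
    by move=> [x y] [].
  move=> [p' [x y]] /= [pp' [xe]]; rewrite gt_max => /andP[My py] q p'q.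
  have /ball_planeP[h1 h2] : ball p (e / 4 + x) q by apply: ball_triangle pp' p'q.
  have [h3 h4] : U (toC q) /\ normc (rho (toC q)) <= M.
    apply: he; rewrite toCB; apply: le_lt_trans (normc_ReIm _) _ => /=.
    lra.
  split => //; first exact: le_trans h4 (ltW My).
  have k1 := lerB_dist q.1 p.1; have k2 := lerB_dist q.2 p.2.
  rewrite distrC in h1; rewrite distrC in h2.
  have p10 : 0 <= `|p.1| by []. have p20 : 0 <= `|p.2| by [].
  by apply/ball_planeP; rewrite /= !sub0r !normrN; split; lra.
move=> H; have [[d M] [/= h d0]] : exists x : R * R, K `<=` P x /\ 0 < x.1.
  apply: (@filter_ex _ (filter_prod ((0 : R)^'+) (+oo_R))); apply: filterI => //.
  exists ([set x | 0 < x], setT); first by split; [exact: nbhs_right_gt|exact: filterT].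
  by move=> [x y] [].
by exists d, M; split => // p q Kp; exact: h.
Qed.

Lemma approximable_monomial (n : nat) (r : R) (U : set R[i]) (rho : R[i] -> R[i])
    (l : seq (bool * 'I_n)) :
  0 < r -> open U -> [locally [bounded rho w | w in U]] -> ae_continuous U rho ->
  ~ dist_vanishes U (iter (size l) (@dist_laplacian R) (dist_of U rho)) ->
  approximable r U rho (monomial l).
Proof.
move=> r0 oU hb [N [mN N0 NU]] /existsNP[phi /not_implyP[[sphi cK KU] /eqP nz]].
set K := closure _ in cK KU.
have [d [M [d0 hd]]] := compact_margin oU hb cK KU.
pose E := \bigcup_(p in K) ball p d.
have oE : open E by apply: bigcup_open => p _; exact: ball_open.
have EA : E `<=` ball 0 M by move=> q [p Kp /(hd _ _ Kp)[]].
have EU : E `<=` @toC R @^-1` U by move=> q [p Kp /(hd _ _ Kp)[]].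
have EM q : E q -> normc (rho (toC q)) <= M by move=> [p Kp /(hd _ _ Kp)[]].
have rhoC q : E q -> ~ N q -> {for toC q, continuous rho}.
  move=> /EU Uq Nq; apply: contrapT => h; apply: Nq; apply: NU => /=.
  by move=> /(_ Uq).
have Kd p : K p -> ball p d `<=` E by move=> Kp q pq; exists p.
have sK : smooth_in K phi.
  split => // p Kp; apply: contrapT => h; apply: Kp; apply: subset_closure.
  exact/eqP.
exact: (approximable_monomial_of_laplacian oE EA EU EM mN N0 rhoC cK d0 Kd r0 sK).
Qed.

End approximable_monomials.

(** * Density of polynomials *)

Section polynomials_for_abs.
Context {R : realType}.

(** The iteration p <- p + (t^2 - p^2) / 2, which increases from 0 to the absolute value of t
    on [-1, 1]. *)
Fixpoint abs_approx n (t : R) : R :=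
  if n is m.+1 then abs_approx m t + 2^-1 * (t * t - abs_approx m t * abs_approx m t)
  else 0.

(** The error u - p is multiplied by at most 1 - u / 2, and the product of this factor
    with 1 + (N + 1) u / 2 is at most 1 + N u / 2.  This gives a bound in 2 / n for the
    error after n steps. *)
Lemma abs_approx_step (u p N : R) : 0 <= u -> u <= 1 -> 0 <= p -> p <= u -> 0 <= N ->
  (u - p) * (1 + N * (u / 2)) <= u ->
  let q := p + 2^-1 * (u * u - p * p) in
  [/\ 0 <= q, q <= u & (u - q) * (1 + (N + 1) * (u / 2)) <= u].
Proof.
move=> u0 u1 p0 pu N0 H /=.
have up1 : 0 <= (u - p) * (u + p) by apply: mulr_ge0; lra.
have up2 : 0 <= (u - p) * (1 - (u + p) / 2) by apply: mulr_ge0; lra.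
split; [lra|lra|].
have -> : u - (p + 2^-1 * (u * u - p * p)) = (u - p) * (1 - (u + p) / 2) by field.
have h1 : (u - p) * (1 - (u + p) / 2) <= (u - p) * (1 - u / 2).
  by rewrite ler_wpM2l ?subr_ge0//; lra.
have h2 : (1 - u / 2) * (1 + (N + 1) * (u / 2)) <= 1 + N * (u / 2).
  rewrite -subr_ge0 [leRHS](_ : _ = (N + 1) * ((u / 2) * (u / 2))); last by field.
  by rewrite mulr_ge0 ?addr_ge0// mulr_ge0// divr_ge0.
apply: le_trans H.
apply: (@le_trans _ _ ((u - p) * (1 - u / 2) * (1 + (N + 1) * (u / 2)))).
  by rewrite ler_wpM2r// addr_ge0// mulr_ge0 ?addr_ge0// divr_ge0.
by rewrite -mulrA ler_wpM2l// subr_ge0.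
Qed.

Lemma abs_approx_bounds n (t : R) : `|t| <= 1 ->
  [/\ 0 <= abs_approx n t, abs_approx n t <= `|t| &
      (`|t| - abs_approx n t) * (1 + n%:R * (`|t| / 2)) <= `|t|].
Proof.
move=> t1; have tt : t * t = `|t| * `|t| by rewrite -normrM ger0_norm// -expr2 sqr_ge0.
elim: n => [|n [p0 pt IH]] /=; first by rewrite subr0 mul0r addr0 mulr1.
rewrite tt (_ : n.+1%:R = n%:R + 1 :> R); last by rewrite natr1.
by apply: abs_approx_step => //; rewrite ler0n.
Qed.

Lemma abs_approx_close n (t : R) : `|t| <= 1 ->
  `|abs_approx n.+1 t - `|t| | <= 2 / n.+1%:R.
Proof.
move=> t1; have [p0 pt] := abs_approx_bounds n.+1 t1.
move: p0 pt; set p := abs_approx n.+1 t => p0 pt H.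
rewrite distrC ger0_norm ?subr_ge0// ler_pdivlMr ?ltr0n//.
have [t0|t0] := eqVneq t 0.
  by rewrite (_ : `|t| - p = 0) ?mul0r//; move: p0 pt; rewrite t0 normr0; lra.
have tp : 0 < `|t| by rewrite normr_gt0.
have a0 : 0 <= `|t| - p by rewrite subr_ge0.
rewrite -(ler_pM2r tp); apply: (@le_trans _ _ (2 * ((`|t| - p) * (1 + n.+1%:R * (`|t| / 2))))).
  rewrite -subr_ge0 [leRHS](_ : _ = 2 * (`|t| - p)); last by field.
  by rewrite mulr_ge0.
by rewrite ler_pM2l.
Qed.

End polynomials_for_abs.

Section stone_weierstrass.
Context {R : realType} {T : topologicalType} (K : set T).
Hypothesis cK : compact K.
Variable A : set (T -> R).
Hypothesis A_continuous : forall f, A f -> {within K, continuous f}.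
Hypothesis A_cst : forall c : R, A (cst c).
Hypothesis A_add : forall f g, A f -> A g -> A (fun x => f x + g x).
Hypothesis A_mul : forall f g, A f -> A g -> A (fun x => f x * g x).
Hypothesis A_limit : forall f, {within K, continuous f} ->
  (forall e : R, 0 < e -> exists2 g, A g & forall x, K x -> `|g x - f x| <= e) -> A f.
Hypothesis A_separates : forall x y, K x -> K y -> x <> y -> exists2 g, A g & g x <> g y.

Let A_scale (c : R) f : A f -> A (fun x => c * f x).
Proof. by move=> Af; apply: A_mul => //; exact: A_cst. Qed.

Let A_bounded f : A f -> exists2 C : R, 0 < C & forall x, K x -> `|f x| <= C.
Proof.
move=> Af; have [M [Mr hM]] := compact_bounded (continuous_compact (A_continuous Af) cK).
exists (`|M| + 1); first by rewrite ltr_wpDl.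
move=> x Kx; apply: hM; last by exists x.
by rewrite ltr_pwDr// ler_norm.
Qed.

Let A_abs_approx n f : A f -> A (fun x => abs_approx n (f x)).
Proof.
move=> Af; elim: n => [|n IH] /=; first exact: A_cst.
apply: A_add => //; apply: A_scale.
rewrite (_ : (fun x => _) = fun x => f x * f x + -1 * (abs_approx n (f x) * abs_approx n (f x))).
  by apply: A_add; [|apply: A_scale]; exact: A_mul.
by apply/funext => x; rewrite mulN1r.
Qed.

Let A_abs f : A f -> A (fun x => `|f x|).
Proof.
move=> Af; apply: A_limit.
  by apply/subspace_continuousP => x Kx; apply: cvg_norm;
    move/subspace_continuousP : (A_continuous Af); apply.
move=> e e0; have [C C0 fC] := A_bounded Af.
pose n := Num.bound (2 * C / e).
have ne : 2 * C / e < n.+1%:R.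
  apply: (@lt_trans _ _ n%:R); last by rewrite ltr_nat.
  by apply: archi_boundP; rewrite divr_ge0 ?mulr_ge0 ?ltW.
exists (fun x => C * abs_approx n.+1 (C^-1 * f x)).
  exact/A_scale/A_abs_approx/A_scale.
move=> x Kx; have t1 : `|C^-1 * f x| <= 1.
  by rewrite normrM gtr0_norm ?invr_gt0// mulrC ler_pdivrMr// mul1r fC.
have := abs_approx_close n t1.
have -> : C * abs_approx n.+1 (C^-1 * f x) - `|f x| =
    C * (abs_approx n.+1 (C^-1 * f x) - `|C^-1 * f x|).
  by rewrite normrM (gtr0_norm (_ : 0 < C^-1)) ?invr_gt0// mulrBr mulrA divff ?mul1r// lt0r_neq0.
move=> h; rewrite [leLHS]normrM (gtr0_norm C0).
apply: le_trans (ler_wpM2l (ltW C0) h) _.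
rewrite mulrA ler_pdivrMr ?ltr0n// (mulrC C).
by rewrite [e * _]mulrC -ler_pdivrMr// ltW.
Qed.

Let A_max f g : A f -> A g -> A (fun x => Num.max (f x) (g x)).
Proof.
move=> Af Ag; rewrite (_ : (fun x => _) =
   fun x => 2^-1 * (f x + g x + `|f x + -1 * g x|)).
  by apply/A_scale/A_add; [exact: A_add|apply/A_abs/A_add => //; exact: A_scale].
by apply/funext => x; rewrite mulN1r maxr_absE; field.
Qed.

Let A_min f g : A f -> A g -> A (fun x => Num.min (f x) (g x)).
Proof.
move=> Af Ag; rewrite (_ : (fun x => _) =
   fun x => 2^-1 * (f x + g x + -1 * `|f x + -1 * g x|)).
  by apply/A_scale/A_add; [exact: A_add|apply/A_scale/A_abs/A_add => //; exact: A_scale].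
by apply/funext => x; rewrite !mulN1r minr_absE; field.
Qed.

Let A_interpolate (f : T -> R) x y : K x -> K y ->
  exists2 g, A g & g x = f x /\ g y = f y.
Proof.
move=> Kx Ky; have [xy|xy] := pselect (x = y).
  by exists (cst (f x)) => //; rewrite xy.
have [g Ag gxy] := A_separates Kx Ky xy.
have d0 : g y - g x != 0 by rewrite subr_eq0; apply/eqP => h; exact: gxy.
exists (fun z => (f y - f x) / (g y - g x) * (g z + (- g x)) + f x).
  apply: A_add; last exact: A_cst.
  by apply: A_scale; apply: A_add => //; exact: A_cst.
by split; [rewrite subrr mulr0 add0r | rewrite mulfVK// subrK].
Qed.

Let lt_near (g f : T -> R) y : K y -> {within K, continuous g} -> {within K, continuous f} ->
  g y < f y -> \forall y' \near y, K y' -> g y' < f y'.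
Proof.
move=> Ky /subspace_continuousP /(_ _ Ky) cg /subspace_continuousP /(_ _ Ky) cf gf.
have c : (fun z => f z - g z) @ within K (nbhs y) --> f y - g y by exact: cvgB.
have h : 0 < f y - g y by rewrite subr_gt0.
have H : nbhs y (fun z => K z -> 0 < f z - g z) by exact: (cvgr_gt _ c _ h).
near=> z => Kz; rewrite -subr_gt0; move: Kz; near: z; exact: H.
Unshelve. all: by end_near.
Qed.

(** Members of A that interpolate f at x and at another point y are below f + e around y.
    The members with value f x at x are directed by pointwise minimum, and compactness is
    applied to the filter of sections of this family instead of a finite cover. *)
Let A_below (f : T -> R) x (e : R) : {within K, continuous f} -> K x -> 0 < e ->
  exists2 h, A h & h x = f x /\ forall y, K y -> h y < f y + e.
Proof.
move=> cf Kx e0; pose Dx := [set h | A h /\ h x = f x].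
pose B h := [set h' | Dx h' /\ forall y, K y -> h' y <= h y].
have FF : Filter (filter_from Dx B).
  apply: filter_from_filter; first by have [g Ag [gx _]] := A_interpolate f Kx Kx; exists g.
  move=> g h [Ag gx] [Ah hx]; exists (fun z => Num.min (g z) (h z)).
    by split; [exact: A_min | rewrite gx hx minxx].
  move=> k [Dk kle]; split; split => // y Ky; apply: le_trans (kle y Ky) _.
    by rewrite ge_min lexx.
  by rewrite ge_min lexx orbT.
have cfe : {within K, continuous (fun y => f y + e)}.
  apply/subspace_continuousP => y Ky; apply: cvgD; last exact: cvg_cst.
  by move/subspace_continuousP : cf; apply.
have : \forall h \near filter_from Dx B, K `<=` (fun y => h y < f y + e).
  have /near_covering_withinP : near_covering K by apply/compact_near_coveringP.
  apply => y Ky; have [g Ag [gx gy]] := A_interpolate f Kx Ky.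
  exists ([set y' | K y' -> g y' < f y' + e], B g).
    split; last by exists g.
    by apply: lt_near (A_continuous Ag) cfe _ => //; rewrite gy ltrDl.
  move=> [y' h] /= [gy' [_ hg]] Ky'; exact: le_lt_trans (hg _ Ky') (gy' Ky').
move=> [h Dh hB]; exists h; first by case: Dh.
by split; [case: Dh | apply: hB; split].
Qed.

(** The functions of [A_below] are above f - e around x, and the members of A below f + e are
    directed by pointwise maximum: compactness applies to them in the same way. *)
Theorem stone_weierstrass (f : T -> R) : {within K, continuous f} -> A f.
Proof.
move=> cf; apply: A_limit => // e e0.
pose De := [set h | A h /\ forall y, K y -> h y < f y + e].
pose B h := [set h' | De h' /\ forall y, K y -> h y <= h' y].
have [[x0 Kx0]|K0] := pselect (exists x, K x); last first.
  by exists (cst 0) => // x Kx; exfalso; apply: K0; exists x.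
have FF : Filter (filter_from De B).
  apply: filter_from_filter.
    by have [g Ag [_ gb]] := A_below cf Kx0 e0; exists g.
  move=> g h [Ag gx] [Ah hx]; exists (fun z => Num.max (g z) (h z)).
    by split; [exact: A_max | move=> y Ky; rewrite gt_max gx// hx].
  move=> k [Dk kle]; split; split => // y Ky; apply: le_trans (kle y Ky).
    by rewrite le_max lexx.
  by rewrite le_max lexx orbT.
have : \forall h \near filter_from De B, K `<=` (fun y => f y < h y + e).
  have /near_covering_withinP : near_covering K by apply/compact_near_coveringP.
  apply => y Ky; have [g Ag [gy gb]] := A_below cf Ky e0.
  have cge : {within K, continuous (fun y => g y + e)}.
    apply/subspace_continuousP => z Kz; apply: cvgD; last exact: cvg_cst.
    by move/subspace_continuousP : (A_continuous Ag); apply.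
  exists ([set y' | K y' -> f y' < g y' + e], B g).
    split; last by exists g.
    by apply: lt_near cf cge _ => //; rewrite gy ltrDl.
  by move=> [y' h] /= [gy' [_ hg]] Ky'; apply: lt_le_trans (gy' Ky') _; rewrite lerD2r hg.
move=> [h Dh hB]; exists h; first by case: Dh.
move=> x Kx; have h1 : f x < h x + e by apply: hB => //; split.
have [_ /(_ x Kx) h2] := Dh.
by rewrite ler_norml; apply/andP; split; lra.
Qed.

End stone_weierstrass.

Section polynomials.
Context {R : realType} (n : nat).
Implicit Types (z : 'rV[R[i]]_n) (P Q : 'rV[R[i]]_n -> R[i]).
Implicit Types (g h : 'rV[R[i]]_n -> R).

Lemma entry_Re_continuous i : continuous (fun z : 'rV[R[i]]_n => complex.Re (z 0 i)).
Proof.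
move=> z; apply: (@continuous_comp _ _ _ (fun z : 'rV[R[i]]_n => z 0 i) (@complex.Re R)).
  exact: coord_continuous.
exact: Re_continuous.
Qed.

Lemma entry_Im_continuous i : continuous (fun z : 'rV[R[i]]_n => complex.Im (z 0 i)).
Proof.
move=> z; apply: (@continuous_comp _ _ _ (fun z : 'rV[R[i]]_n => z 0 i) (@complex.Im R)).
  exact: coord_continuous.
exact: Im_continuous.
Qed.

Lemma enorm_continuous : continuous (@enorm R n).
Proof.
have cs : continuous (fun z : 'rV[R[i]]_n => \sum_(i < n) normc (z 0 i) ^+ 2).
  apply: continuous_big => [|k _]; first exact: add_continuous.
  have E (w : 'rV[R[i]]_n) : normc (w 0 k) ^+ 2 = complex.Re (w 0 k) * complex.Re (w 0 k) +
      complex.Im (w 0 k) * complex.Im (w 0 k).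
    by case: (w 0 k) => a b /=; rewrite sqr_sqrtr ?addr_ge0 ?sqr_ge0// !expr2.
  rewrite (eq_fun E) => z.
  have cR := @entry_Re_continuous k z; have cI := @entry_Im_continuous k z.
  exact: (cvgD (cvgM cR cR) (cvgM cI cI)).
by move=> z; apply: continuous_comp (cs z) _; exact: sqrt_continuous.
Qed.

(** The ball is a closed subset of a product of compact squares. *)
Lemma compact_ecball (r : R) : compact (@ecball R n r).
Proof.
pose S := @toC R @` (`[- r, r]%classic `*` `[- r, r]%classic).
have cS : compact S.
  apply: continuous_compact; last by apply: compact_setX; exact: segment_compact.
  by apply: continuous_subspaceT; exact: toC_continuous.
apply: (@subclosed_compact _ _ [set v : 'rV[R[i]]_n | forall i, S (v ord0 i)]).
- apply: (@closed_comp _ _ (@enorm R n) [set x | x <= r]).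
    by move=> z _; exact: enorm_continuous.
  exact: (@closed_le R r).
- by apply: (@rV_compact _ _ (fun=> S)) => _.
- move=> z Bz i; have h := normc_coord i Bz.
  exists (complex.Re (z 0 i), complex.Im (z 0 i)); last by rewrite /toC /=; case: (z 0 i).
  split; rewrite /= in_itv /= -ler_norml; apply: le_trans h;
    [exact: normc_Re | exact: normc_Im].
Qed.

Definition polynomial P := exists s : seq (R[i] * seq (bool * 'I_n)),
  forall z, P z = \sum_(x <- s) x.1 * monomial x.2 z.

Lemma polynomial_cst (c : R[i]) : polynomial (cst c).
Proof. by exists [:: (c, [::])] => z; rewrite big_seq1 /= mulr1. Qed.

Lemma polynomialD P Q : polynomial P -> polynomial Q -> polynomial (fun z => P z + Q z).
Proof. by move=> [s Ps] [t Qt]; exists (s ++ t) => z; rewrite big_cat /= Ps Qt. Qed.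

Lemma monomial_cat (l l' : seq (bool * 'I_n)) z :
  monomial (l ++ l') z = monomial l z * monomial l' z.
Proof. by elim: l => [|x l IH] /=; rewrite ?mul1r// IH mulrA. Qed.

Lemma polynomialM P Q : polynomial P -> polynomial Q -> polynomial (fun z => P z * Q z).
Proof.
move=> [s Ps] [t Qt].
exists [seq (x.1 * y.1, x.2 ++ y.2) | x <- s, y <- t] => z.
rewrite big_allpairs_dep Ps Qt big_distrlr /=; apply: eq_bigr => x _; apply: eq_bigr => y _.
by rewrite monomial_cat mulrACA.
Qed.

Lemma polynomial_coord b i : polynomial (fun z => if b then z 0 i else (z 0 i)^*).
Proof. by exists [:: (1, [:: (b, i)])] => z; rewrite big_seq1 /= mul1r mulr1. Qed.

Lemma polynomial_Re i : polynomial (fun z => (complex.Re (z 0 i))%:C).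
Proof.
have := polynomialM (polynomialD (polynomial_coord true i) (polynomial_coord false i))
   (polynomial_cst 2%:R^-1).
by move=> [s h]; exists s => z; rewrite -h ReJ_add.
Qed.

Lemma polynomial_Im i : polynomial (fun z => (complex.Im (z 0 i))%:C).
Proof.
have := polynomialM (polynomialD (polynomial_coord false i)
   (polynomialM (polynomial_cst (- 1)) (polynomial_coord true i)))
   (polynomial_cst (2%:R^-1 * 'i%C)).
by move=> [s h]; exists s => z; rewrite -h ImJ_sub /= mulN1r mulrA.
Qed.

Variable r : R.

(** Polynomials in the z_i and their conjugates take complex values; their real-valued limits
    form the real algebra to which the Stone-Weierstrass theorem applies. *)
Definition poly_limit (g : 'rV[R[i]]_n -> R) : Prop :=
  {within @ecball R n r, continuous g} /\
  forall e : R, 0 < e -> exists2 P, polynomial P &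
    forall z, ecball r z -> normc (P z - (g z)%:C) <= e.

Lemma poly_limit_bounded g : poly_limit g ->
  exists2 C : R, 0 < C & forall z, ecball r z -> `|g z| <= C.
Proof.
move=> [cg _].
have [M [Mr hM]] := compact_bounded (continuous_compact cg (@compact_ecball r)).
exists (`|M| + 1); first by rewrite ltr_wpDl.
move=> x Kx; apply: hM; last by exists x.
by rewrite ltr_pwDr// ler_norm.
Qed.

Lemma poly_limit_of (g : 'rV[R[i]]_n -> R) :
  continuous g -> polynomial (fun z => (g z)%:C) -> poly_limit g.
Proof.
move=> cg pg; split; first exact: continuous_subspaceT.
move=> e e0; exists (fun z => (g z)%:C) => // z _.
by rewrite subrr normc0 ltW.
Qed.

Lemma poly_limitD g h : poly_limit g -> poly_limit h -> poly_limit (fun z => g z + h z).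
Proof.
move=> [cg ag] [ch ah]; split.
  apply/subspace_continuousP => z Bz; apply: cvgD.
    by move/subspace_continuousP : cg; apply.
  by move/subspace_continuousP : ch; apply.
move=> e e0; have e20 : 0 < e / 2 by rewrite divr_gt0.
have [P pP Pg] := ag _ e20; have [Q pQ Qh] := ah _ e20.
exists (fun z => P z + Q z); first exact: polynomialD.
move=> z Bz; rewrite rmorphD /= opprD addrACA (splitr e).
by apply: le_trans (le_normcD _ _) _; rewrite lerD ?Pg ?Qh.
Qed.

Lemma poly_limitM g h : poly_limit g -> poly_limit h -> poly_limit (fun z => g z * h z).
Proof.
move=> lg lh; have [[cg ag] [ch ah]] := (lg, lh); split.
  apply/subspace_continuousP => z Bz; apply: cvgM.
    by move/subspace_continuousP : cg; apply.
  by move/subspace_continuousP : ch; apply.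
move=> e e0; have [C C0 gC] := poly_limit_bounded lg; have [C' C'0 hC'] := poly_limit_bounded lh.
pose d := Num.min 1 (e / (C + C' + 1)).
have d0 : 0 < d by rewrite lt_min ltr01 divr_gt0//; lra.
have d1 : d <= 1 by rewrite ge_min lexx.
have de : d * (C + C' + 1) <= e.
  by rewrite -ler_pdivlMr ?ge_min ?lexx ?orbT//; lra.
have [P pP Pg] := ag _ d0; have [Q pQ Qh] := ah _ d0.
exists (fun z => P z * Q z); first exact: polynomialM.
move=> z Bz.
have -> : P z * Q z - (g z * h z)%:C = (P z - (g z)%:C) * (Q z - (h z)%:C) +
    ((P z - (g z)%:C) * (h z)%:C + (g z)%:C * (Q z - (h z)%:C)).
  by rewrite rmorphM /=; ring.
apply: le_trans (le_normcD _ _) _; apply: le_trans (lerD (lexx _) (le_normcD _ _)) _.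
rewrite !normcM !normc_real.
have p1 := Pg z Bz; have q1 := Qh z Bz; have g1 := gC z Bz; have h1 := hC' z Bz.
apply: le_trans de; rewrite [leRHS](_ : _ = d * 1 + (d * C' + C * d)); last by ring.
apply: lerD; last apply: lerD.
- by apply: ler_pM; rewrite ?normc_ge0// (le_trans q1).
- by apply: ler_pM; rewrite ?normc_ge0.
- by apply: ler_pM; rewrite ?normc_ge0.
Qed.

Lemma poly_limit_dense (g : 'rV[R[i]]_n -> R) :
  {within @ecball R n r, continuous g} -> poly_limit g.
Proof.
apply: (stone_weierstrass (@compact_ecball r) (A := poly_limit)).
- by move=> f [].
- by move=> c; apply: poly_limit_of; [exact: cst_continuous | exact: (polynomial_cst c%:C)].
- exact: poly_limitD.
- exact: poly_limitM.
- move=> f cf h; split => // e e0; have e20 : 0 < e / 2 by rewrite divr_gt0.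
  have [k [_ ak] kf] := h _ e20; have [P pP Pk] := ak _ e20; exists P => // z Bz.
  have -> : P z - (f z)%:C = (P z - (k z)%:C) + (k z - f z)%:C by rewrite rmorphB /=; ring.
  by apply: le_trans (le_normcD _ _) _; rewrite (splitr e) normc_real lerD ?Pk ?kf.
- move=> x y _ _ xy.
  have [j xyj] : exists j, x 0 j != y 0 j.
    apply/existsP; apply: contra_notT xy; rewrite negb_exists => /forallP h.
    by apply/rowP => j; apply/eqP; rewrite -[_ == _]negbK.
  move: xyj; rewrite eq_complex negb_and => /orP[/eqP h|/eqP h].
    exists (fun z => complex.Re (z 0 j)) => //.
    by apply: poly_limit_of; [exact: entry_Re_continuous | exact: polynomial_Re].
  exists (fun z => complex.Im (z 0 j)) => //.
  by apply: poly_limit_of; [exact: entry_Im_continuous | exact: polynomial_Im].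
Qed.

End polynomials.

Section density.
Context {R : realType} (n : nat) (r : R) (U : set R[i]) (rho : R[i] -> R[i]).

Lemma approximable_polynomial (P : 'rV[R[i]]_n -> R[i]) :
  (forall l : seq (bool * 'I_n), approximable r U rho (monomial l)) ->
  polynomial P -> approximable r U rho P.
Proof.
move=> am [s Ps]; apply: (eq_approximable (F := fun z => \sum_(x <- s) x.1 * monomial x.2 z)).
  by move=> z _; rewrite Ps.
elim: s {Ps} => [|x s IH].
  apply: eq_approximable (approximableZ 0 (am [::])) => z _.
  by rewrite big_nil mul0r.
apply: eq_approximable (approximableD (approximableZ x.1 (am x.2)) IH) => z _.
by rewrite big_cons.
Qed.

Lemma approximable_continuous (F : 'rV[R[i]]_n -> R[i]) :
  (forall l : seq (bool * 'I_n), approximable r U rho (monomial l)) ->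
  {within @ecball R n r, continuous (fun z => complex.Re (F z))} ->
  {within @ecball R n r, continuous (fun z => complex.Im (F z))} ->
  approximable r U rho F.
Proof.
move=> am cRe cIm; apply: approximable_lim => e e0.
have e20 : 0 < e / 2 by rewrite divr_gt0.
have [_ /(_ _ e20) [P pP Pf]] := poly_limit_dense cRe.
have [_ /(_ _ e20) [Q pQ Qf]] := poly_limit_dense cIm.
exists (fun z => P z + 'i%C * Q z).
  apply: approximableD; first exact: approximable_polynomial.
  by apply: approximableZ; exact: approximable_polynomial.
move=> z Bz.
have FE : F z = (complex.Re (F z))%:C + 'i%C * (complex.Im (F z))%:C.
  exact: complexE.
rewrite [X in normc X](_ : _ = (P z - (complex.Re (F z))%:C) +
  'i%C * (Q z - (complex.Im (F z))%:C)).
  apply: le_trans (le_normcD _ _) _; rewrite (splitr e) lerD ?Pf//.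
  by rewrite normcM normc_i mul1r Qf.
by rewrite {1}FE; ring.
Qed.

End density.

Section assembly.
Context {R : realType}.

Lemma enorm_le_sum (k : nat) (v : 'rV[R[i]]_k) : enorm v <= \sum_(j < k) normc (v 0 j).
Proof.
have [s0 ss] : 0 <= \sum_(j < k) normc (v 0 j) /\
    \sum_(j < k) normc (v 0 j) ^+ 2 <= (\sum_(j < k) normc (v 0 j)) ^+ 2.
  elim/big_ind2 : _ => [|a b c d [b0 ab] [d0 cd]|j _]; first by rewrite expr0n.
    split; first exact: addr_ge0.
    rewrite sqrrD; apply: (le_trans (lerD ab cd)).
    by rewrite -addrA [X in _ <= _ + X]addrC lerD2l lerDl mulrn_wge0// mulr_ge0.
  by split => //; exact: normc_ge0.
by rewrite /enorm -[leRHS](ger0_norm s0) -sqrtr_sqr ler_wsqrtr.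
Qed.

(** The network of output k is given outer weights on the k-th coordinate only, and the
    networks of all outputs are concatenated. *)
Lemma simultaneous_networks (n k0 : nat) (r : R) (U : set R[i]) (rho : R[i] -> R[i])
    (F : 'I_k0 -> 'rV[R[i]]_n -> R[i]) :
  (forall k, approximable r U rho (F k)) -> forall e : R, 0 < e ->
  exists s : seq ('cV[R[i]]_k0 * ('rV[R[i]]_n * R[i])),
    (forall x z, x \in s -> ecball r z -> U (cdot x.2.1 z + x.2.2)) /\
    forall k z, ecball r z ->
      normc (\sum_(x <- s) x.1 k 0 * rho (cdot x.2.1 z + x.2.2) - F k z) <= e.
Proof.
move=> aF e e0; have /choice[S hS] := fun k => aF k e e0.
exists (flatten [seq [seq (x.1 *: delta_mx k 0, x.2) | x <- S k] | k <- enum 'I_k0]).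
split.
  move=> x z /flatten_mapP[k _ /mapP[y yS ->]] /=.
  by have [adm _] := hS k; exact: (adm y z yS).
move=> k z Bz; have [_ /(_ z Bz)] := hS k; congr (normc (_ - _) <= _).
rewrite big_flatten big_map big_enum /= (bigD1 k)//= [X in _ = _ + X]big1 ?addr0.
  rewrite big_map /=; apply: eq_bigr => x _.
  by rewrite !mxE !eqxx mulr1.
move=> j jk; rewrite big_map /= big1// => x _.
by rewrite !mxE eq_sym (negbTE jk) /= mulr0 mul0r.
Qed.

End assembly.

(** * The universal approximation theorem *)

Theorem theorem19 (R : realType) (i0 k0 : nat) (hi0 : (0 < i0)%N)
    (hk0 : (0 < k0)%N) (r : R) (hr : 0 < r)
    (U : set R[i]) (hUo : open U) (hU0 : U !=set0)
    (rho : R[i] -> R[i])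
    (hbnd : [locally [bounded rho w | w in U]])
    (hae : ae_continuous U rho)
    (hlap : forall m : nat,
       ~ dist_vanishes U (iter m (@dist_laplacian R) (dist_of U rho)))
    (f : 'rV[R[i]]_i0 -> 'rV[R[i]]_k0)
    (hf : {within @ecball R i0 r, continuous f})
    (eps : R) (heps : 0 < eps) :
  exists (j0 : nat) (a : 'I_j0 -> 'rV[R[i]]_i0) (b : 'rV[R[i]]_j0)
      (c : 'M[R[i]]_(k0, j0)),
    [/\ (0 < j0)%N,
        forall (z : 'rV[R[i]]_i0) (j : 'I_j0),
          ecball r z -> U (cdot (a j) z + b 0 j)
      & let N (z : 'rV[R[i]]_i0) : 'rV[R[i]]_k0 :=
          \row_k \sum_(j < j0) c k j * rho (cdot (a j) z + b 0 j) in
        (ereal_sup [set (enorm (N z - f z))%:E | z in @ecball R i0 r]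
           <= eps%:E)%E].
Proof.
have am (l : seq (bool * 'I_i0)) : approximable r U rho (monomial l).
  exact: approximable_monomial.
have cf (g : 'rV[R[i]]_k0 -> R) : continuous g ->
    {within @ecball R i0 r, continuous (g \o f)}.
  move=> cg; apply/subspace_continuousP => z Bz.
  by apply: continuous_cvg; [exact: cg | move/subspace_continuousP : hf; apply].
have af k : approximable r U rho (fun z => f z 0 k).
  apply: (approximable_continuous am).
    exact: (cf _ (@entry_Re_continuous _ _ k)).
  exact: (cf _ (@entry_Im_continuous _ _ k)).
have k00 : 0 < k0%:R :> R by rewrite ltr0n.
have [s [adm hs]] := simultaneous_networks af (divr_gt0 heps k00).
have [u0 Uu0] := hU0.
(* A unit of weight 0 makes the network nonempty; its bias is a point of U. *)
pose x0 : 'cV[R[i]]_k0 * ('rV[R[i]]_i0 * R[i]) := (0, (0, u0)).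
pose s' := x0 :: s; pose x j := nth x0 s' j.
have adm' (y : 'cV[R[i]]_k0 * ('rV[R[i]]_i0 * R[i])) z :
    y \in s' -> ecball r z -> U (cdot y.2.1 z + y.2.2).
  rewrite inE => /predU1P[-> _|]; last exact: adm.
  by rewrite /cdot big1 ?add0r// => j _; rewrite mxE mul0r.
exists (size s'), (fun j => (x j).2.1), (\row_j (x j).2.2), (\matrix_(k, j) (x j).1 k 0).
split => //.
  by move=> z j Bz; rewrite mxE; apply: adm' => //; exact: mem_nth.
move=> N; apply: ge_ereal_sup => _ [z Bz <-]; rewrite lee_fin.
have NE k : N z 0 k = \sum_(y <- s) y.1 k 0 * rho (cdot y.2.1 z + y.2.2).
  rewrite mxE; under eq_bigr do rewrite !mxE.
  rewrite -(big_mkord predT (fun j => (x j).1 k 0 * rho (cdot (x j).2.1 z + (x j).2.2))).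
  rewrite -(big_nth x0 predT (fun y => y.1 k 0 * rho (cdot y.2.1 z + y.2.2))).
  by rewrite big_cons /= mxE mul0r add0r.
apply: le_trans (enorm_le_sum _) _.
apply: (@le_trans _ _ (\sum_(k < k0) eps / k0%:R)).
  by apply: ler_sum => k _; rewrite [_ 0 k]mxE [(- f z) 0 k]mxE NE; exact: hs.
by rewrite sumr_const card_ord -[leLHS]mulr_natr divfK// lt0r_neq0.
Qed.
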